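(* Let $B$ be a regular $A_{n-1}$-crystal. For $b\in B$, we have \begin{equation*} {\rm charge}(b) =\sum_{\alpha\in \Delta^+_{n-1}}\min\{ \varepsilon_\alpha( b ), \varphi_\alpha(b)\}. \end{equation*}
   Context: $\Delta^+_{n-1}=\{\epsilon_s-\epsilon_t\mid 1\le s<t\le n\}$. For $\alpha=\epsilon_s-\epsilon_t$, $\varepsilon_\alpha(b)=\varepsilon_s(S_{s+1}S_{s+2}\cdots S_{t-1}(b))$ and $\varphi_\alpha(b)=\varphi_s(S_{s+1}\cdots S_{t-1}(b))$, where $S_j$ is the $\mathfrak S_n$-action on $B$ associated to $r_j=(j\ j+1)$. The charge on $B$ is defined as follows: the connected component of $b$ is isomorphic to $B(\lambda)$ for some generalized partition $\lambda\in\mathbb{Z}^n_+$; choosing $d\ge0$ with $\lambda+(d^n)$ a partition, $b$ is identified with a tableau $T\in SST_{[n]}(\lambda+(d^n))$, and ${\rm charge}(b)=c(T')$, the Lascoux–Schützenberger charge of the unique tableau $T'$ of dominant weight in the $\mathfrak{S}_n$-orbit of $T$ (independent of $d$). *)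

(* Defs.v *)
From Stdlib Require Import Relation_Operators.
From mathcomp Require Import all_boot all_order all_algebra.
From mathcomp Require Import boolp classical_sets.

Set Implicit Arguments.
Unset Strict Implicit.
Unset Printing Implicit Defensive.
Import Order.TTheory GRing.Theory Num.Theory.
Local Open Scope ring_scope.

(** Everything is 0-based: the letters 1, ..., n are 0, ..., n - 1, the weight
    lattice of gl_n is ['rV[int]_n], and the nodes of the Dynkin diagram
    A_(n-1) are the [j : 'I_n.-1], node [j] linking the coordinates [j] and
    [j + 1]. *)

Lemma hi_proof n (j : 'I_n.-1) : (j.+1 < n)%N.
Proof. by rewrite -ltn_predRL. Qed.

Definition lo n (j : 'I_n.-1) : 'I_n := widen_ord (leq_pred n) j.
Definition hi n (j : 'I_n.-1) : 'I_n := Ordinal (hi_proof j).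

Definition simple_root n (j : 'I_n.-1) : 'rV[int]_n :=
  delta_mx 0 (lo j) - delta_mx 0 (hi j).
Definition coroot n (j : 'I_n.-1) (l : 'rV[int]_n) : int :=
  l 0 (lo j) - l 0 (hi j).

(** For [l : 'rV[int]_n]: [l] is a generalized partition. *)
Definition dominant n (l : 'rV[int]_n) : Prop :=
  forall j : 'I_n.-1, l 0 (hi j) <= l 0 (lo j).

(** * Crystals of type A_(n-1) *)

(** [None] is the formal element 0.  The value -oo of [eps] and [phi], allowed
    in general crystals, never occurs in a regular one and is left out. *)
Record crystal_data (n : nat) := CrystalData {
  car :> Type;
  wt : car -> 'rV[int]_n;
  eps : 'I_n.-1 -> car -> int;
  phi : 'I_n.-1 -> car -> int;
  ce : 'I_n.-1 -> car -> option car;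
  cf : 'I_n.-1 -> car -> option car }.

Record crystal (n : nat) := Crystal {
  cdata :> crystal_data n;
  phi_eps : forall j (b : cdata), phi j b = eps j b + coroot j (wt b);
  ce_axiom : forall j (b b' : cdata), ce j b = Some b' ->
    [/\ wt b' = wt b + simple_root j,
        eps j b' = eps j b - 1 & phi j b' = phi j b + 1];
  cf_axiom : forall j (b b' : cdata), cf j b = Some b' ->
    [/\ wt b' = wt b - simple_root j,
        eps j b' = eps j b + 1 & phi j b' = phi j b - 1];
  cf_ce : forall j (b b' : cdata), cf j b = Some b' <-> ce j b' = Some b }.

(** The action of [r_j]: reflection of the [j]-string through [b].  In a regular
    crystal the iterates below are never [None]. *)
Definition weyl n (B : crystal_data n) (j : 'I_n.-1) (b : B) : B :=
  let k := coroot j (wt b) in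
  odflt b (iter `|k|%N (obind (if 0 <= k then cf j else ce j)) (Some b)).

Definition in_orbit n (B : crystal_data n) (b b' : B) : Prop :=
  exists s : seq 'I_n.-1, b' = foldr (@weyl n B) b s.

Definition connected n (B : crystal_data n) : B -> B -> Prop :=
  clos_refl_sym_trans B (fun x y => exists j, cf j x = Some y).

(** Since 0 <= s < t < n, the index [s] of the root [eps_s - eps_t] is a node;
    [weyl_between s t b] is S_(s+1) (S_(s+2) (... S_(t-1) (b))). *)
Definition weyl_between n (B : crystal_data n) (s : 'I_n.-1) (t : 'I_n) (b : B)
    : B :=
  foldr (@weyl n B) b [seq j : 'I_n.-1 <- enum 'I_n.-1 | (s < j < t)%N].

Definition eps_root n (B : crystal_data n) (a : 'I_n.-1 * 'I_n) (b : B) : int :=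
  eps a.1 (weyl_between a.1 a.2 b).
Definition phi_root n (B : crystal_data n) (a : 'I_n.-1 * 'I_n) (b : B) : int :=
  phi a.1 (weyl_between a.1 a.2 b).

(** * Words: the word x1 x2 ... is x1 (x) x2 (x) ..., with Kashiwara's tensor
    product rule:
      eps (b1 (x) b2) = eps b1 + max (0, eps b2 - phi b1),
      phi (b1 (x) b2) = phi b2 + max (0, phi b1 - eps b2),
      e (b1 (x) b2) = e b1 (x) b2 if phi b1 >= eps b2, else b1 (x) e b2,
      f (b1 (x) b2) = f b1 (x) b2 if phi b1 > eps b2, else b1 (x) f b2,
    where a letter x has phi_i = [x = i] and eps_i = [x = i + 1]. *)

Section Words.
Local Open Scope nat_scope.

Fixpoint weps (i : nat) (w : seq nat) : nat :=
  if w is x :: w' then (x == i.+1) + (weps i w' - (x == i)) else 0.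

Fixpoint wphi (i : nat) (w : seq nat) : nat :=
  if w is x :: w' then wphi i w' + ((x == i) - weps i w') else 0.

Fixpoint we (i : nat) (w : seq nat) : option (seq nat) :=
  if w is x :: w' then
    if weps i w' <= (x == i) then
      if x == i.+1 then Some (i :: w') else None
    else omap (cons x) (we i w')
  else None.

Fixpoint wf (i : nat) (w : seq nat) : option (seq nat) :=
  if w is x :: w' then
    if weps i w' < (x == i) then Some (i.+1 :: w')
    else omap (cons x) (wf i w')
  else None.

(** * Lascoux-Schützenberger charge of a word whose weight is a partition *)

(** Charge of a permutation of 0, ..., m - 1: the smallest letter has index 0,
    and the index increases by 1 from [r] to [r + 1] exactly when [r + 1] stands
    to the left of [r]; the charge is the sum of the indices. *)
Fixpoint charge_index (w : seq nat) (r : nat) : nat :=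
  if r is r'.+1 then charge_index w r' + (index r w < index r' w) else 0.
Definition std_charge (w : seq nat) : nat :=
  \sum_(r < size w) charge_index w r.

(** First occurrence of [r] from position [p] on, cyclically. *)
Definition next_pos (w : seq nat) (r p : nat) : nat :=
  if r \in drop p w then p + index r (drop p w) else index r w.

(** Positions of the letters [r], [r + 1], ..., [r + m - 1] selected from
    position [p] on. *)
Fixpoint sel_pos (w : seq nat) (r p m : nat) : seq nat :=
  if m is m'.+1 then let q := next_pos w r p in q :: sel_pos w r.+1 q m'
  else [::].

Definition selection (w : seq nat) : bitseq :=
  let ps := sel_pos w 0 0 (size (undup w)) in
  [seq q \in ps | q <- iota 0 (size w)].

Fixpoint charge_rec (fuel : nat) (w : seq nat) : nat :=
  if fuel is k.+1 then
    if w is [::] then 0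
    else std_charge (mask (selection w) w)
         + charge_rec k (mask (map negb (selection w)) w)
  else 0.

(** Each extraction removes at least one letter, so [size w] rounds suffice. *)
Definition ls_charge (w : seq nat) : nat := charge_rec (size w) w.

(** * Semistandard tableaux, as sequences of rows from top to bottom *)

Definition column_strict (r1 r2 : seq nat) : bool :=
  (size r2 <= size r1)
  && all (fun j => nth 0 r1 j < nth 0 r2 j) (iota 0 (size r2)).

(** The shape may have trailing zeros, which are empty rows of the tableau. *)
Definition is_sst (n : nat) (mu : seq nat) (T : seq (seq nat)) : bool :=
  [&& shape T == mu, all (sorted leq) T, sorted column_strict T
    & all (all (fun x => x < n)) T].

(** Each row is read from right to left, the rows from top to bottom. *)
Definition reading (T : seq (seq nat)) : seq nat := flatten [seq rev r | r <- T].
Definition unreading (mu w : seq nat) : seq (seq nat) :=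
  [seq rev r | r <- reshape mu w].

Definition tableau_charge (T : seq (seq nat)) : nat := ls_charge (reading T).

End Words.

(** The crystal operators on tableaux are those of the reading words. *)
Definition tableaux (n : nat) : crystal_data n :=
  @CrystalData n (seq (seq nat))
    (fun T => \row_(i < n) (count_mem (i : nat) (reading T))%:Z)
    (fun j T => (weps j (reading T))%:Z)
    (fun j T => (wphi j (reading T))%:Z)
    (fun j T => omap (unreading (shape T)) (we j (reading T)))
    (fun j T => omap (unreading (shape T)) (wf j (reading T))).

(** * Regular crystals and charge *)

(** The partition [l + (d^n)], when its entries are nonnegative. *)
Definition shifted_shape n (l : 'rV[int]_n) (d : nat) : seq nat :=
  [seq `|(l 0 i + d%:Z)%R|%N | i <- enum 'I_n].

(** [psi] identifies the connected component of [b] with B(l), realized as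
    SST_[n](l + (d^n)) with all weights translated by -(d^n).  Only the values
    of [psi] on this component matter. *)
Record identifies n (B : crystal_data n) (b : B) (l : 'rV[int]_n) (d : nat)
    (psi : B -> tableaux n) : Prop := Identifies {
  id_shape : forall i, 0 <= l 0 i + d%:Z;
  id_sst : forall x, connected b x -> is_sst n (shifted_shape l d) (psi x);
  id_inj : forall x y, connected b x -> connected b y -> psi x = psi y -> x = y;
  id_surj : forall T, is_sst n (shifted_shape l d) T ->
    exists2 x, connected b x & psi x = T;
  id_wt : forall x, connected b x -> wt (psi x) = wt x + const_mx d%:Z;
  id_eps : forall j x, connected b x -> eps j (psi x) = eps j x;
  id_phi : forall j x, connected b x -> phi j (psi x) = phi j x;
  id_ce : forall j x, connected b x -> ce j (psi x) = omap psi (ce j x);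
  id_cf : forall j x, connected b x -> cf j (psi x) = omap psi (cf j x) }.

Definition regular n (B : crystal n) : Prop :=
  forall b : B, exists (l : 'rV[int]_n) (d : nat) (psi : B -> tableaux n),
    dominant l /\ identifies b l d psi.

Definition is_charge n (B : crystal n) (b : B) (c : nat) : Prop :=
  exists (l : 'rV[int]_n) (d : nat) (psi : B -> tableaux n) (T' : tableaux n),
    [/\ dominant l, identifies b l d psi, in_orbit (psi b) T',
        dominant (wt T') & c = tableau_charge T'].

(** In a regular crystal exactly one [c] satisfies [is_charge b c], whatever the
    choice of [d] and of the identification. *)
Definition charge n (B : crystal n) (b : B) : nat :=
  xget 0%N [set c | is_charge b c]%classic.

(* Main.v *)
(** The cyclic point of view on words drives the proof.  Bracketing each letter
    [i] with an [i+1] to its right around a circle, [S_i] relabels the unmatched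
    letters of the majority, so it commutes with rotation, and
    [min (eps_i, phi_i)] counts the matched pairs that straddle the cut.  When
    the cut moves past a position, this number changes by the difference of the
    indicators of [i] before and [i+1] after applying [S_i].

    On three consecutive letters [min_(i+1) + min_i o S_(i+1)] is invariant under
    [S_i]: both sides are piecewise linear in the entries of the P-tableau of the
    word.  Comparing this identity at all the cuts of a circular word shows that
    [S_i S_(i+1) S_i] and [S_i S_(i+1)] put [i] at the same positions, which is
    the part of the braid relation needed to prove that the sum over all roots is
    invariant under every [S_j]; so the word may be taken dominant.

    For a dominant word, let [E_t] be the part of the sum over the roots
    [eps_s - eps_t] and [k] the number of letters [t].  Keeping only the [k]
    leftmost smallest letters does not change [E_t], and then the energy identity
    turns [E_t] into the number of wraps of [k] tokens that move from the letters
    [0] to the letters [1], ..., to the letters [t], each to the next free one on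
    its right.  The order in which the tokens move is irrelevant, so letting the
    first one travel alone is the extraction of the first Lascoux-Schützenberger
    subword, and [E_t] drops by the contribution of its letter [t]. *)

Require Import Defs.
From Stdlib Require Import Relation_Operators.
From mathcomp Require Import all_boot all_order all_algebra zify.
From mathcomp Require Import boolp classical_sets.
Import Order.TTheory GRing.Theory Num.Theory.
Local Open Scope ring_scope.

Set Implicit Arguments.
Unset Strict Implicit.
Unset Printing Implicit Defensive.

(** * Strings and reflections on words *)

Section Words.
Local Open Scope nat_scope.

(** The element with [weps i = k] of the [i]-string through [w]; meaningful only
    for [k <= weps i w + wphi i w]. *)
Fixpoint wstring (i k : nat) (w : seq nat) : seq nat :=
  if w is x :: u then
    if (x == i) && (0 < weps i u) then i :: wstring i k.+1 u
    else if (x == i) || (x == i.+1) then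
      if k is k'.+1 then i.+1 :: wstring i k' u else i :: wstring i 0 u
    else x :: wstring i k u
  else [::].

(** Reflecting an [i]-string exchanges [weps] and [wphi], hence the parameter [wphi i w]. *)
Definition wrefl (i : nat) (w : seq nat) : seq nat := wstring i (wphi i w) w.

Definition wmin (i : nat) (w : seq nat) : nat := minn (weps i w) (wphi i w).

Variant letter2_spec i x : bool -> bool -> Type :=
| Letter21 of x = i : letter2_spec i x true false
| Letter22 of x = i.+1 : letter2_spec i x false true
| Letter2N of x != i & x != i.+1 : letter2_spec i x false false.

Lemma letter2P i x : letter2_spec i x (x == i) (x == i.+1).
Proof.
have n1 : (i == i.+1) = false by lia.
case: (eqVneq x i) => [->|]; first by rewrite n1; constructor.
by case: (eqVneq x i.+1); constructor.
Qed.

Lemma size_wstring i k w : size (wstring i k w) = size w.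
Proof.
elim: w k => //= x u IH k.
by do 2?[case: ifP => _]; case: k => [|k] /=; rewrite ?IH.
Qed.

Lemma wstring_eps_phi i k w : k <= weps i w + wphi i w ->
  weps i (wstring i k w) = k /\ wphi i (wstring i k w) + k = weps i w + wphi i w.
Proof.
have n1 : (i.+1 == i) = false by lia.
have n2 : (i == i.+1) = false by lia.
elim: w k => [|x u IH] k /=; first lia.
case: (letter2P i x) => [->|->|xi xi1] /=.
- move=> Hk; case: ifPn => [H|H].
    have [|] := IH k.+1; first lia.
    by rewrite /= eqxx n2 /=; lia.
  case: k Hk => [|k] Hk.
    have [|] := IH 0; first lia.
    by rewrite /= eqxx n2 /=; lia.
  have [|] := IH k; first lia.
  by rewrite /= eqxx n1 /=; lia.
- move=> Hk; case: k Hk => [|k] Hk.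
    have [|] := IH 0; first lia.
    by rewrite /= eqxx n2 /=; lia.
  have [|] := IH k; first lia.
  by rewrite /= eqxx n1 /=; lia.
move=> Hk; have [|] := IH k; first lia.
by rewrite /= (negPf xi) (negPf xi1) /=; lia.
Qed.

Lemma weps_wstring i k w : k <= weps i w + wphi i w -> weps i (wstring i k w) = k.
Proof. by case/wstring_eps_phi. Qed.

Lemma wphi_wstring i k w : k <= weps i w + wphi i w ->
  wphi i (wstring i k w) = weps i w + wphi i w - k.
Proof. by case/wstring_eps_phi=> *; lia. Qed.

Lemma wstring_id i w : wstring i (weps i w) w = w.
Proof.
elim: w => //= x u IH.
case: (letter2P i x) => [->|->|xi xi1] /=.
- case E : (weps i u) IH => [|k] IH /=; first by rewrite IH.
  by rewrite add0n subn1 /= IH.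
- by rewrite subn0 IH.
by rewrite subn0 IH.
Qed.

Lemma wstring_wstring i k l w : k <= weps i w + wphi i w ->
  l <= weps i w + wphi i w -> wstring i l (wstring i k w) = wstring i l w.
Proof.
have neqS : (i.+1 == i) = false by lia.
have neqS' : (i == i.+1) = false by lia.
elim: w k l => [|x u IH] k l //=.
case: (letter2P i x) => [->|->|xi xi1] /=.
- move=> Hk Hl.
  case: ifPn => [H|H].
    rewrite /= eqxx weps_wstring; last lia.
    by rewrite /= IH //; lia.
  have e0 : weps i (wstring i 0 u) = 0 by rewrite weps_wstring.
  have IH0 : wstring i 0 (wstring i 0 u) = wstring i 0 u by rewrite IH.
  case: k l Hk Hl => [|k] [|l] Hk Hl /=; rewrite ?eqxx ?neqS /= ?e0 /= ?IH //; lia.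
- move=> Hk Hl.
  have e0 : weps i (wstring i 0 u) = 0 by rewrite weps_wstring.
  case: k l Hk Hl => [|k] [|l] Hk Hl /=; rewrite ?eqxx ?neqS /= ?e0 /= ?IH //; lia.
by move=> Hk Hl /=; rewrite (negPf xi) (negPf xi1) /= IH //; lia.
Qed.

(** Raising moves one step along the string parametrised by [weps]; with [wstring_wstring] this
    makes iterates of [we], and likewise of [wf], explicit. *)
Lemma weE i w :
  we i w = if weps i w is k.+1 then Some (wstring i k w) else None.
Proof.
elim: w => //= x u ->.
case: (letter2P i x) => [->|->|xi xi1] /=.
- by rewrite add0n; case: (weps i u) => [|[|k]].
- rewrite subn0 add0n; case E : (weps i u) (wstring_id i u) => [|k] Ew //=.
  by rewrite Ew.
by rewrite subn0 add0n; case: (weps i u).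
Qed.

Lemma wfE i w :
  wf i w = if 0 < wphi i w then Some (wstring i (weps i w).+1 w) else None.
Proof.
elim: w => //= x u ->.
case: (letter2P i x) => [->|->|xi xi1] /=.
- rewrite add0n; case E : (weps i u) (wstring_id i u) => [|k] Ew.
    by rewrite addn1 /= Ew.
  by rewrite addn0 subn1 /=; case: (0 < wphi i u).
- by rewrite sub0n addn0 subn0; case: (0 < wphi i u).
by rewrite sub0n addn0 subn0; case: (0 < wphi i u).
Qed.

Lemma weps_count i w :
  weps i w + count_mem i w = wphi i w + count_mem i.+1 w.
Proof. by elim: w => //= x u IH; case: letter2P => [_|_|_ _]; lia. Qed.

Lemma weps_le_count i w : weps i w <= count_mem i.+1 w.
Proof. by elim: w => //= x u IH; lia. Qed.

Lemma wreflK i : involutive (wrefl i).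
Proof.
move=> w; have H : wphi i w <= weps i w + wphi i w by lia.
rewrite {1}/wrefl wphi_wstring // addnK wstring_wstring ?wstring_id //; lia.
Qed.

Lemma weps_wrefl i w : weps i (wrefl i w) = wphi i w.
Proof. by rewrite weps_wstring //; lia. Qed.

Lemma wphi_wrefl i w : wphi i (wrefl i w) = weps i w.
Proof. by rewrite wphi_wstring; lia. Qed.

Lemma wmin_wrefl i w : wmin i (wrefl i w) = wmin i w.
Proof. by rewrite /wmin weps_wrefl wphi_wrefl minnC. Qed.

Lemma size_wrefl i w : size (wrefl i w) = size w.
Proof. exact: size_wstring. Qed.

Lemma weps_rcons i w x :
  weps i (rcons w x) = weps i w + ((x == i.+1) - wphi i w).
Proof.
suff : weps i (rcons w x) = weps i w + ((x == i.+1) - wphi i w) /\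
       wphi i (rcons w x) = (x == i) + (wphi i w - (x == i.+1)) by case.
elim: w => [|y u [IH1 IH2]] /=; first by split; lia.
by rewrite IH1 IH2; split; lia.
Qed.

Lemma wphi_rcons i w x :
  wphi i (rcons w x) = (x == i) + (wphi i w - (x == i.+1)).
Proof. by elim: w => [|y u IH] /=; rewrite ?IH ?weps_rcons; lia. Qed.

(** [wstring] consumes a word from the left; this is its rule at the right end, needed when the cut
    of a circular word moves past a letter. A final [i + 1] is matched exactly when an open [i]
    precedes it; an unmatched final letter is the last one that can become [i + 1]. *)
Lemma wstring_rcons i k w x : k <= weps i (rcons w x) + wphi i (rcons w x) ->
  wstring i k (rcons w x) =
  if (x == i.+1) && (0 < wphi i w) then rcons (wstring i k w) x
  else if (x == i) || (x == i.+1) then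
    if k <= weps i w + wphi i w then rcons (wstring i k w) i
    else rcons (wstring i (weps i w + wphi i w) w) i.+1
  else rcons (wstring i k w) x.
Proof.
rewrite weps_rcons wphi_rcons.
have n1 : (i == i.+1) = false by lia.
have n2 : (i.+1 == i) = false by lia.
elim: w k => [|y u IH] k.
  rewrite /= andbF.
  by case: (letter2P i x) => [->|->|_ _] /=; rewrite ?n1 ?n2; case: k => [|[|k]].
rewrite /= weps_rcons => Hk.
case: (letter2P i x) IH Hk => [xE|xE|xi xi1] /=; case: (letter2P i y) => [_|_|yi yi1];
move: (weps i u) (wphi i u) => p q IH; case: p IH => [|p] IH; case: q IH => [|q] IH;
rewrite /= ?(subn0, sub0n, subSS, subnn, addn0, add0n, addn1, addSn) ?ltnS => Hk;
rewrite /= ?(subn0, sub0n, subSS, subnn, addn0, add0n) ?ltnS in IH.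
all: try (case: k Hk => [|k] Hk; rewrite /= IH //; lia).
all: try (case: k Hk => [|k] Hk /=); rewrite ?IH; try lia.
all: try (repeat (case: ifPn => ?); rewrite //=; try lia;
  do ?congr (_ :: _); do ?congr rcons; try congr wstring; lia).
Qed.

(** * Three consecutive letters *)

(** [tXY] is the number of letters [i + Y - 1] in row [X] of a semistandard
    tableau with letters [i], [i + 1], [i + 2]; inserting [x] in the first row
    matches [cons x] on words. *)
Record tab3 :=
  Tab3 { t11 : nat; t12 : nat; t13 : nat; t22 : nat; t23 : nat; t33 : nat }.

Definition tab3_valid T :=
  [/\ t22 T <= t11 T, t33 T <= t22 T & t22 T + t23 T <= t11 T + t12 T].

Definition tab3_bump1 T :=
  let: Tab3 a b c d e f := T in
  if b is b'.+1 then
    if e is e'.+1 then Tab3 a.+1 b' c d.+1 e' f.+1 else Tab3 a.+1 b' c d.+1 e f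
  else if c is c'.+1 then Tab3 a.+1 b c' d e.+1 f
  else Tab3 a.+1 b c d e f.

Definition tab3_bump2 T :=
  let: Tab3 a b c d e f := T in
  if c is c'.+1 then Tab3 a b.+1 c' d e.+1 f else Tab3 a b.+1 c d e f.

Definition tab3_bump3 T :=
  let: Tab3 a b c d e f := T in Tab3 a b c.+1 d e f.

Definition tab3_insert i x T :=
  if x == i then tab3_bump1 T else if x == i.+1 then tab3_bump2 T
  else if x == i.+2 then tab3_bump3 T else T.

Definition tab3_of i w := foldr (tab3_insert i) (Tab3 0 0 0 0 0 0) w.

(** Each [i + 1] of row 2 is matched with an [i] of row 1, so only the split of row 1 between [i]
    and [i + 1] varies along an [i]-string. *)
Definition tab3_set1 k T :=
  let: Tab3 a b c d e f := T in Tab3 (a + b - k) k c d e f.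

(** The unmatched letters [i + 1], [i + 2] occupy [c + (b - e)] places of row 1,
    read first, and then places of row 2; [i + 2] must fill the first [k]. *)
Definition tab3_set2 k T :=
  let: Tab3 a b c d e f := T in
  let c' := minn k (c + (b - e)) in
  let e' := minn b e + k - c' in
  Tab3 a (b + c - c') c' (d + e - e') e' f.

Variant letter3_spec i x : bool -> bool -> bool -> Type :=
| Letter1 of x = i : letter3_spec i x true false false
| Letter2 of x = i.+1 : letter3_spec i x false true false
| Letter3 of x = i.+2 : letter3_spec i x false false true
| LetterN of x != i & x != i.+1 & x != i.+2 : letter3_spec i x false false false.

Lemma letter3P i x : letter3_spec i x (x == i) (x == i.+1) (x == i.+2).
Proof.
have n1 : (i == i.+1) = false by lia.
have n2 : (i.+1 == i.+2) = false by lia.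
have n3 : (i == i.+2) = false by lia.
case: (eqVneq x i) => [->|]; first by rewrite n1 n3; constructor.
case: (eqVneq x i.+1) => [->|]; first by rewrite n2; constructor.
by case: (eqVneq x i.+2) => [->|]; constructor.
Qed.

(** String lengths depend only on the insertion tableau, which makes them piecewise linear in its
    six entries. Validity is carried along to control the truncated subtractions. *)
Lemma tab3_spec i w : [/\ tab3_valid (tab3_of i w),
   weps i w = t12 (tab3_of i w),
   wphi i w = t11 (tab3_of i w) - t22 (tab3_of i w),
   weps i.+1 w =
     t13 (tab3_of i w) + (t23 (tab3_of i w) - t12 (tab3_of i w)) &
   wphi i.+1 w = (t22 (tab3_of i w) - t33 (tab3_of i w)) +
     (t12 (tab3_of i w) - t23 (tab3_of i w))].
Proof.
elim: w => // x u [].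
rewrite /= /tab3_insert /tab3_valid.
case: (tab3_of i u) => a b c d e f /= [V1 V2 V3] -> -> -> ->.
case: letter3P => [_|_|_|_ _ _]; case: b V3 => [|b] V3; case: c => [|c];
  case: e V3 => [|e] V3; split=> /=; try split=> /=; lia.
Qed.

Lemma tab3_insertE i T :
  (tab3_insert i i T = tab3_bump1 T) * (tab3_insert i i.+1 T = tab3_bump2 T) *
  (tab3_insert i i.+2 T = tab3_bump3 T).
Proof.
have n2 : (i.+1 == i) = false by lia.
have n3 : (i.+2 == i) = false by lia.
have n4 : (i.+2 == i.+1) = false by lia.
by rewrite /tab3_insert !eqxx n2 n3 n4.
Qed.

(** Insertion intertwines strings of words with strings of tableaux, so that identities between
    reflected words become identities between tableau entries. *)
Lemma tab3_wstring1 i k w : k <= weps i w + wphi i w ->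
  tab3_of i (wstring i k w) = tab3_set1 k (tab3_of i w).
Proof.
elim: w k => [|x u IH] k; first by case: k.
have [] := tab3_spec i u; rewrite /tab3_valid.
case ET : (tab3_of i u) IH => [a b c d e f] IH /= [V1 V2 V3] E1 P1 _ _.
move=> Hk; rewrite ET.
case: (letter3P i x) Hk => [->|->|->|x1 x2 x3] Hk /=.
- case: ifPn => [H|H].
    rewrite /= IH ?tab3_insertE /=; last lia; rewrite ?tab3_insertE.
    rewrite /tab3_set1 /tab3_bump1.
    case: b V3 E1 {IH ET} => [|b] V3 E1; first lia.
    by case: e V3 => [|e] V3; rewrite /=; congr Tab3; lia.
  have b0 : b = 0 by lia.
  case: k Hk => [|k] Hk /=; rewrite IH ?tab3_insertE /=; try lia;
  by rewrite b0; case: (c) => [|c'] /=; congr Tab3; lia.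
- case: k Hk => [|k] Hk /=; rewrite IH ?tab3_insertE /=; try lia;
  by case: c {IH ET} => [|c] /=; congr Tab3; lia.
- rewrite IH ?tab3_insertE /=; last lia.
  by rewrite /=; congr Tab3; lia.
rewrite IH /tab3_insert ?(negPf x1) ?(negPf x2) ?(negPf x3) //=; lia.
Qed.

Lemma tab3_wstring2 i k w : k <= weps i.+1 w + wphi i.+1 w ->
  tab3_of i (wstring i.+1 k w) = tab3_set2 k (tab3_of i w).
Proof.
elim: w k => [|x u IH] k; first by case: k.
have [] := tab3_spec i u; rewrite /tab3_valid.
case ET : (tab3_of i u) IH => [a b c d e f] IH /= [V1 V2 V3] _ _ E1 P1.
move=> Hk; rewrite ET {ET}; rewrite E1 P1 in IH Hk *; clear E1 P1.
case: (letter3P i x) Hk => [->|->|->|x1 x2 x3] Hk /=.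
- rewrite IH ?tab3_insertE; last lia.
  move: Hk; rewrite /= !subn0 !add0n !sub0n addn0 => Hk; clear IH.
  rewrite /tab3_set2 /tab3_bump1 /=.
  case EB: (b + c - minn k (c + (b - e))) => [|b1].
    case EC: (minn k (c + (b - e))) => [|c1];
    case: b Hk V3 EB EC => [|b] Hk V3 EB EC;
    case: e Hk V3 EB EC => [|e] Hk V3 EB EC;
    case: c Hk V3 EB EC => [|c] Hk V3 EB EC; try lia;
    rewrite /=; congr Tab3; lia.
  case EC: (minn b e + k - minn k (c + (b - e))) => [|c1];
  case: b Hk V3 EB EC => [|b] Hk V3 EB EC;
  case: e Hk V3 EB EC => [|e] Hk V3 EB EC;
  case: c Hk V3 EB EC => [|c] Hk V3 EB EC; try lia;
  rewrite /=; congr Tab3; lia.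
- case: ifPn => [H|H].
    rewrite /= IH; last lia.
    move: Hk; rewrite !tab3_insertE /= !add0n => Hk; clear IH.
    rewrite /tab3_set2 /tab3_bump2.
    case EC: (minn _ _) => [|c1];
    case: c H Hk EC => [|c] H Hk EC; try lia; rewrite /=; congr Tab3; lia.
  have c0 : c = 0 by lia.
  have be0 : e - b = 0 by lia.
  move: Hk H; rewrite c0 be0 /= !add0n => Hk _.
  case: k Hk => [|k] Hk /=; rewrite IH ?tab3_insertE /=; try lia; clear IH;
  rewrite c0 /tab3_bump2 /tab3_bump3.
    by case EC: (minn _ _) => [|c1]; rewrite /=; congr Tab3; lia.
  by rewrite /=; congr Tab3; lia.
- case: k Hk => [|k] Hk /=; rewrite IH ?tab3_insertE /=; try lia; clear IH.
    by rewrite !min0n; congr Tab3; lia.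
  by move: Hk; rewrite /= !subn0 add1n => Hk; congr Tab3; lia.
rewrite IH /tab3_insert ?(negPf x1) ?(negPf x2) ?(negPf x3) //=.
by rewrite /= in Hk; lia.
Qed.

(** On tableaux [wrefl i] only exchanges two parameters, so the claim is the symmetry of one
    piecewise linear function, checked on its regions of linearity. *)
Lemma energy_adjacent i w :
  wmin i.+1 (wrefl i w) + wmin i (wrefl i.+1 (wrefl i w)) =
  wmin i.+1 w + wmin i (wrefl i.+1 w).
Proof.
have min1 u : wmin i u =
    minn (t12 (tab3_of i u)) (t11 (tab3_of i u) - t22 (tab3_of i u)).
  by rewrite /wmin; have [_ -> -> _ _] := tab3_spec i u.
have min2 u : wmin i.+1 u =
    minn (t13 (tab3_of i u) + (t23 (tab3_of i u) - t12 (tab3_of i u)))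
      (t22 (tab3_of i u) - t33 (tab3_of i u) +
        (t12 (tab3_of i u) - t23 (tab3_of i u))).
  by rewrite /wmin; have [_ _ _ -> ->] := tab3_spec i u.
have refl1 u : tab3_of i (wrefl i u) =
    tab3_set1 (t11 (tab3_of i u) - t22 (tab3_of i u)) (tab3_of i u).
  rewrite tab3_wstring1; last lia.
  by have [_ _ -> _ _] := tab3_spec i u.
have refl2 u : tab3_of i (wrefl i.+1 u) =
    tab3_set2 (t22 (tab3_of i u) - t33 (tab3_of i u) +
      (t12 (tab3_of i u) - t23 (tab3_of i u))) (tab3_of i u).
  rewrite tab3_wstring2; last lia.
  by have [_ _ _ _ ->] := tab3_spec i u.
rewrite !(min1, min2, refl1, refl2).
have [] := tab3_spec i w; rewrite /tab3_valid.
case: (tab3_of i w) => a b c d e f /= [V1 V2 V3] _ _ _ _.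
(* The new variables [A = a - d] and [D = d - f] replace [a] and [d]; two of the inequalities of a
   valid tableau then hold by construction, and the third becomes [V4]. *)
rewrite -(subnK V1) -(subnK V2) in V3 *.
move: (d - f) (a - (d - f + f)) V3 => D A V3; rewrite !addnK {V1 V2 a d}.
(* [F b A] is the right-hand side; [wrefl i] swaps [b] and [A]. *)
pose F b0 A0 := minn (c + (e - b0)) (D + (b0 - e)) +
    minn (b0 + c - minn (D + (b0 - e)) (c + (b0 - e)))
      (A0 + (D + f) - (D + f + e -
        (minn b0 e + (D + (b0 - e)) - minn (D + (b0 - e)) (c + (b0 - e))))).
have V4 : e <= A + b by lia.
have F1 b0 A0 : e <= b0 -> D <= c ->
    F b0 A0 = minn c (D + (b0 - e)) + minn (e + c - D) A0.
  move=> eb Dc; rewrite /F.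
  have -> : minn (D + (b0 - e)) (c + (b0 - e)) = D + (b0 - e) by lia.
  have -> : minn b0 e = e by lia.
  have -> : e - b0 = 0 by lia.
  by rewrite addnK addnK addn0; congr (_ + minn _ _); lia.
have F2 b0 A0 : e <= b0 -> c <= D -> F b0 A0 = c + minn e (A0 + D - c).
  move=> eb cD; rewrite /F.
  have -> : minn (D + (b0 - e)) (c + (b0 - e)) = c + (b0 - e) by lia.
  have -> : minn b0 e = e by lia.
  have -> : e - b0 = 0 by lia.
  have -> : minn (c + 0) (D + (b0 - e)) = c by lia.
  by congr (_ + minn _ _); lia.
have F3 b0 A0 : b0 <= e -> D <= c ->
    F b0 A0 = D + minn (b0 + c - D) (A0 - (e - b0)).
  move=> be Dc; rewrite /F.
  have -> : b0 - e = 0 by lia.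
  have -> : minn b0 e = b0 by lia.
  rewrite !addn0 (minn_idPl Dc).
  have -> : minn (c + (e - b0)) D = D by lia.
  by congr (_ + minn _ _); lia.
have F4 b0 A0 : e <= A0 + b0 -> b0 <= e -> c <= D ->
    F b0 A0 = minn (c + (e - b0)) D + minn b0 (A0 + D - c - (e - b0)).
  move=> eAb be cD; rewrite /F.
  have -> : b0 - e = 0 by lia.
  have -> : minn b0 e = b0 by lia.
  rewrite !addn0 (minn_idPr cD).
  by congr (_ + minn _ _); lia.
rewrite -/(F b A).
have -> : A + (D + f) + b - A = b + (D + f) by lia.
rewrite -/(F A b).
have FE b0 A0 : e <= A0 + b0 -> F b0 A0 =
    if D <= c then
      if e <= b0 then minn c (D + (b0 - e)) + minn (e + c - D) A0
      else D + minn (b0 + c - D) (A0 - (e - b0))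
    else if e <= b0 then c + minn e (A0 + D - c)
      else minn (c + (e - b0)) D + minn b0 (A0 + D - c - (e - b0)).
  move=> V5; case: (leqP D c) => [Dc|/ltnW cD]; case: (leqP e b0) => [eb|/ltnW be].
  - exact: F1.
  - exact: F3.
  - exact: F2.
  exact: F4.
rewrite !FE; [|lia|lia].
by case: (leqP D c) => ?; case: (leqP e b) => ?; case: (leqP e A) => ?; lia.
Qed.

(** * Rotation and the braid relation *)

(** Moving the first letter to the end leaves the cyclic bracketing alone, so the reflection rotates
    along. The second equation counts the pairs that begin or cease to straddle the cut; the last
    two clauses confine the change of the letter to [i] and [i + 1]. *)
Lemma wrefl_rcons i x u : [/\
  wrefl i (rcons u x) =
    rcons (behead (wrefl i (x :: u))) (head 0 (wrefl i (x :: u))),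
  wmin i (rcons u x) + (head 0 (wrefl i (x :: u)) == i.+1) =
    wmin i (x :: u) + (x == i),
  (head 0 (wrefl i (x :: u)) == i) + (head 0 (wrefl i (x :: u)) == i.+1) =
    (x == i) + (x == i.+1) &
  x != i -> x != i.+1 -> head 0 (wrefl i (x :: u)) = x].
Proof.
have n1 : (i == i.+1) = false by lia.
have n2 : (i.+1 == i) = false by lia.
rewrite /wrefl wstring_rcons ?wphi_rcons; last by lia.
rewrite /wmin !weps_rcons !wphi_rcons /=.
case: (letter2P i x) => [->|->|xi xi1] /=.
- case E : (weps i u) => [|m] /=.
    rewrite !subn0 addn1 ltnn eqxx n2 /=; split=> //; lia.
  rewrite !subn0 eqxx n1 addn0.
  have -> : 1 + wphi i u <= m.+1 + wphi i u by lia.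
  by split=> //; [congr (rcons (wstring _ _ _) _)|]; lia.
- rewrite sub0n addn0; case E : (wphi i u) => [|m] /=; last first.
    by rewrite eqxx n2 subn1 !subn0 !add0n; split=> //; lia.
  by rewrite eqxx n1 !add0n; split=> //; lia.
rewrite !subn0 !sub0n !add0n !addn0 (negPf xi) (negPf xi1).
by split=> //; lia.
Qed.

Lemma wrefl_rot i p w : wrefl i (rot p w) = rot p (wrefl i w).
Proof.
have r1 v : wrefl i (rot 1 v) = rot 1 (wrefl i v).
  case: v => [|x u]; first by [].
  have [e _ _ _] := wrefl_rcons i x u; have := size_wrefl i (x :: u).
  by rewrite rot1_cons e; case: (wrefl i (x :: u)) => // y t _; rewrite rot1_cons.
elim: p => [|p IH]; first by rewrite !rot0.
have [pw|wp] := ltnP p (size w).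
  by rewrite (rotS pw) r1 IH [RHS]rotS ?size_wrefl.
by rewrite !rot_oversize ?size_wrefl //; exact: leqW.
Qed.

(** [mark P u = mark P v] says that [u] and [v] have the same letters satisfying
    [P] at the same positions. *)
Definition mark (P : pred nat) (w : seq nat) : seq nat :=
  [seq if P x then x.+1 else 0 | x <- w].

Lemma mark_letters i (P : pred nat) u v : P i -> P i.+1 -> mark P u = mark P v ->
  weps i u = weps i v /\ wphi i u = wphi i v.
Proof.
move=> Pi Pi1; elim: u v => [|x u IH] [|y v] //= [exy /IH [<- <-]].
move: exy; case: ifP => Px; case: ifP => Py //; first by case=> <-.
have [xi xi1] : x != i /\ x != i.+1 by split; apply: contraFneq Px => ->.
have [yi yi1] : y != i /\ y != i.+1 by split; apply: contraFneq Py => ->.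
by rewrite !(negPf xi, negPf xi1, negPf yi, negPf yi1).
Qed.

Lemma mark_wstring i k (P : pred nat) u v : P i -> P i.+1 -> mark P u = mark P v ->
  mark P (wstring i k u) = mark P (wstring i k v).
Proof.
move=> Pi Pi1; elim: u v k => [|x u IH] [|y v] k //= [exy euv].
have [-> _] := mark_letters Pi Pi1 euv.
move: exy; case: ifP => Px; case: ifP => Py //.
  case=> <-; case: ifP => _ /=; first by rewrite (IH v).
  case: ifP => _ /=; last by rewrite (IH v).
  by case: k => [|k] /=; rewrite (IH v).
have [xi xi1] : x != i /\ x != i.+1 by split; apply: contraFneq Px => ->.
have [yi yi1] : y != i /\ y != i.+1 by split; apply: contraFneq Py => ->.
by rewrite !(negPf xi, negPf xi1, negPf yi, negPf yi1) /= Px Py (IH v).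
Qed.

Lemma mark_wrefl i (P : pred nat) u v : P i -> P i.+1 -> mark P u = mark P v ->
  mark P (wrefl i u) = mark P (wrefl i v).
Proof.
move=> Pi Pi1 euv; have [_ e] := mark_letters Pi Pi1 euv.
by rewrite /wrefl e; exact: mark_wstring.
Qed.

Lemma mark_wmin i (P : pred nat) u v : P i -> P i.+1 -> mark P u = mark P v ->
  wmin i u = wmin i v.
Proof.
by move=> Pi Pi1 euv; rewrite /wmin; have [-> ->] := mark_letters Pi Pi1 euv.
Qed.

Lemma mark_wrefl_id i (P : pred nat) w : ~~ P i -> ~~ P i.+1 ->
  mark P (wrefl i w) = mark P w.
Proof.
move=> Pi Pi1; rewrite /wrefl; move: (wphi i w) => k.
elim: w k => [|x u IH] k //=.
case: (letter2P i x) => [->|->|_ _] /=; last by rewrite IH.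
  case: ifP => _; first by rewrite /= (negPf Pi) IH.
  by case: k => [|k] /=; rewrite ?(negPf Pi) ?(negPf Pi1) IH.
by case: k => [|k] /=; rewrite ?(negPf Pi) ?(negPf Pi1) IH.
Qed.

Lemma mark_sub (P Q : pred nat) u v : subpred P Q -> mark Q u = mark Q v ->
  mark P u = mark P v.
Proof.
move=> PQ; elim: u v => [|x u IH] [|y v] //= [exy /IH ->].
congr cons; move: exy; case: ifP => Qx; case: ifP => Qy //; first by case=> ->.
by rewrite (contraFF (PQ x) Qx) (contraFF (PQ y) Qy).
Qed.

Lemma mark_union (P Q R : pred nat) u v : (forall x, R x -> P x || Q x) ->
  mark P u = mark P v -> mark Q u = mark Q v -> mark R u = mark R v.
Proof.
move=> RPQ eP eQ; apply: (@mark_sub _ (predU P Q)); first exact: RPQ.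
elim: u v eP eQ {RPQ} => [|x u IH] [|y v] //= [exy /IH e1] [exy' /e1 ->].
congr cons; move: exy exy'.
by case: (P x) (P y) => [] [] /=; case: (Q x) (Q y) => [] [] //= [] // ->.
Qed.

Lemma mark_inj (P Q : pred nat) u v : (forall x, P x || Q x) ->
  mark P u = mark P v -> mark Q u = mark Q v -> u = v.
Proof.
move=> PQ eP eQ; have /= := mark_union (R := predT) (fun x _ => PQ x) eP eQ.
have inj : injective (fun x : nat => x.+1) by move=> x y [].
exact: (inj_map inj).
Qed.

(** The two reflections act on disjoint sets of letters; comparing the letters up to [j + 1] and
    those above separately settles the whole word. *)
Lemma wrefl_comm i j w : j.+1 < i ->
  wrefl i (wrefl j w) = wrefl j (wrefl i w).
Proof.
move=> ji; apply: (@mark_inj (fun x => x <= j.+1) (fun x => j.+1 < x)).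
- by move=> x; lia.
- rewrite [LHS]mark_wrefl_id; [|lia|lia].
  by apply: mark_wrefl; [lia|lia|rewrite mark_wrefl_id //; lia].
- rewrite [RHS]mark_wrefl_id; [|lia|lia].
  by apply: mark_wrefl; [lia|lia|rewrite mark_wrefl_id //; lia].
Qed.

(** By [wrefl_rcons], the energy identity for [w] and its rotation differ exactly
    by the two indicators compared here, at the first position. *)
Lemma wrefl_braid_mark j w :
  mark (pred1 j) (wrefl j (wrefl j.+1 (wrefl j w))) =
  mark (pred1 j) (wrefl j (wrefl j.+1 w)).
Proof.
have same y x : (y == j) + (y == j.+1) = (x == j) + (x == j.+1) ->
    (x != j -> x != j.+1 -> y = x) -> (y == j.+2) = (x == j.+2) :> bool.
  case: (letter2P j x) => [->|->|xj xj1] p o; [lia|lia|by rewrite o].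
have headE v : (head 0 (wrefl j (wrefl j.+1 (wrefl j v))) == j) =
               (head 0 (wrefl j (wrefl j.+1 v)) == j) \/ size v = 0.
  case: v => [|x u]; [by right|left].
  have e0 := energy_adjacent j (x :: u); have e1 := energy_adjacent j (rcons u x).
  have [r1 h1 p1 o1] := wrefl_rcons j x u.
  have [r2 h2 p2 o2] := wrefl_rcons j.+1 x u.
  move: e0 e1; rewrite r1 r2.
  have := size_wrefl j.+1 (x :: u); have := size_wrefl j (x :: u).
  case E1 : (wrefl j (x :: u)) r1 h1 p1 o1 => [//|x1 u1] /= r1 h1 p1 o1 _.
  case E2 : (wrefl j.+1 (x :: u)) r2 h2 p2 o2 => [//|y2 v2] /= r2 h2 p2 o2 _.
  have [r3 h3 p3 o3] := wrefl_rcons j.+1 x1 u1.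
  have [r4 h4 p4 o4] := wrefl_rcons j y2 v2.
  rewrite r3; have := size_wrefl j.+1 (x1 :: u1).
  case E3 : (wrefl j.+1 (x1 :: u1)) r3 h3 p3 o3 => [//|y3 v3] /= r3 h3 p3 o3 _.
  have [r5 h5 p5 o5] := wrefl_rcons j y3 v3.
  move: (head 0 (wrefl j (y3 :: v3))) h5 p5 o5 => z5 h5 p5 o5.
  move: (head 0 (wrefl j (y2 :: v2))) h4 p4 o4 => z4 h4 p4 o4.
  move=> e0 e1.
  (* [wrefl j] does not move the letters [j + 2]. Once this is substituted, the claim follows
     linearly from the two energy identities, with indicators read as numbers via [can_inj oddb]. *)
  have sm := same _ _ p1 o1; move: sm h1 h2 h3 h4 h5 p2 p3 p4 p5 p1 e0 e1.
  move=> -> h1 h2 h3 h4 h5 p2 p3 p4 p5 p1 e0 e1; apply: (can_inj oddb).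
  move: h1 h2 h3 h4 h5 p2 p3 p4 p5 p1 e0 e1.
  do !(move: (nat_of_bool _)); do !(move: (wmin _ _)); clear.
  lia.
apply: (@eq_from_nth _ 0); first by rewrite !size_map !size_wrefl.
move=> p; rewrite size_map !size_wrefl => pw.
rewrite !(nth_map 0) ?size_wrefl //=.
(* Rotating by [p] brings position [p] to the front, and rotation commutes with the reflections, so
   the comparison of heads suffices. *)
have nthE v : p < size v -> nth 0 v p = head 0 (rot p v).
  by move=> pv; rewrite -nth0 /rot nth_cat size_drop subn_gt0 pv nth_drop addn0.
rewrite !nthE ?size_wrefl // -!wrefl_rot.
have [e|] := headE (rot p w); last by rewrite size_rot; lia.
by case: eqP e => [->|_]; case: eqP => [->|].
Qed.

(** * The energy of the letter [t] *)

Definition wbetween (s t : nat) (w : seq nat) : seq nat :=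
  foldr wrefl w (iota s.+1 (t - s.+1)).

Lemma wbetween_id s t w : t <= s.+1 -> wbetween s t w = w.
Proof. by rewrite /wbetween -subn_eq0 => /eqP ->. Qed.

Lemma wbetween_cat s j t w : s < j -> j < t ->
  wbetween s t w = wbetween s j (wrefl j (wbetween j t w)).
Proof.
move=> sj jt; rewrite /wbetween.
have -> : t - s.+1 = (j - s.+1) + (t - j.+1).+1 by lia.
by rewrite iotaD foldr_cat subnKC.
Qed.

Lemma wbetween_rec s t w : s.+1 < t ->
  wbetween s t w = wrefl s.+1 (wbetween s.+1 t w).
Proof. by move=> st; rewrite (@wbetween_cat s s.+1) // wbetween_id. Qed.

Lemma wbetween_last s t w : s < t ->
  wbetween s t.+1 w = wbetween s t (wrefl t w).
Proof. by move=> st; rewrite (@wbetween_cat s t) // (@wbetween_id t). Qed.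

Lemma mark_wbetween s t (P : pred nat) u v :
  (forall x, s < x <= t -> P x) -> mark P u = mark P v ->
  mark P (wbetween s t u) = mark P (wbetween s t v).
Proof.
move=> sP uv; have : forall x, x \in iota s.+1 (t - s.+1) -> P x && P x.+1.
  by move=> x; rewrite mem_iota => H; rewrite !sP //; lia.
rewrite /wbetween; elim: (iota _ _) => //= x l IH H.
have /andP[Px Px1] := H x (mem_head x l).
by apply: mark_wrefl => //; apply: IH => y yl; apply: H; rewrite inE yl orbT.
Qed.

Lemma mark_wbetween_id s t (P : pred nat) w :
  (forall x, s < x <= t -> ~~ P x) -> mark P (wbetween s t w) = mark P w.
Proof.
move=> sP; have : forall x, x \in iota s.+1 (t - s.+1) -> ~~ P x && ~~ P x.+1.
  by move=> x; rewrite mem_iota => H; rewrite !sP //; lia.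
rewrite /wbetween; elim: (iota _ _) => //= x l IH H.
have /andP[Px Px1] := H x (mem_head x l).
rewrite mark_wrefl_id //.
by apply: IH => y yl; apply: H; rewrite inE yl orbT.
Qed.

Lemma wbetween_wrefl s t j w : j < s ->
  wbetween s t (wrefl j w) = wrefl j (wbetween s t w).
Proof.
move=> js; have : forall x, x \in iota s.+1 (t - s.+1) -> j.+1 < x.
  by move=> x; rewrite mem_iota; lia.
rewrite /wbetween; elim: (iota _ _) => //= x l IH H.
rewrite IH; last by move=> y yl; apply: H; rewrite inE yl orbT.
by apply: wrefl_comm; apply: H; rewrite mem_head.
Qed.

(** For [r = 0] this is the contribution of the roots ending at [t]; a general lower bound [r]
    allows levels to be peeled off one at a time. *)
Definition wenergy (r t : nat) (w : seq nat) : nat :=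
  \sum_(r <= s < t) wmin s (wbetween s t w).

(** For [s < j] only the letters up to [j] matter, and [wrefl_braid_mark] applies. The terms [s = j]
    and [s = j + 1] are traded by the energy identity. For [s > j + 1] the reflection touches no
    relevant letter. *)
Lemma wenergy_wrefl r t j w : r <= j -> j.+1 < t ->
  wenergy r t (wrefl j w) = wenergy r t w.
Proof.
move=> rj jt; rewrite /wenergy.
rewrite !(@big_cat_nat _ _ _ j.+2 r t) /=; [|lia..].
rewrite !(@big_cat_nat _ _ _ j r j.+2) /=; [|lia..].
congr (_ + _ + _).
- apply: eq_big_nat => s /andP[_ sj].
  rewrite !(@wbetween_cat s j t); [|lia..].
  rewrite !(@wbetween_rec j t) // !(@wbetween_wrefl j.+1 t j) //.
  apply: (@mark_wmin _ (fun x => x <= j)); [rewrite /=; lia|rewrite /=; lia|].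
  apply: mark_wbetween; first by move=> x; lia.
  apply: (@mark_union (fun x => x < j) (pred1 j)).
  - by move=> x /=; lia.
  - by rewrite !mark_wrefl_id //=; lia.
  exact: wrefl_braid_mark.
- rewrite !(big_ltn (_ : j < j.+2)) // !big_nat1.
  rewrite !(@wbetween_rec j t) // !(@wbetween_wrefl j.+1 t j) //.
  by rewrite addnC energy_adjacent addnC.
apply: eq_big_nat => s /andP[js _].
apply: (@mark_wmin _ (fun x => j.+1 < x)); [rewrite /=; lia|rewrite /=; lia|].
apply: mark_wbetween; first by move=> x; lia.
by rewrite mark_wrefl_id //=; lia.
Qed.

(** The energies of [t < j] and [t > j + 1] are individually invariant, while those of [j] and
    [j + 1] are exchanged up to the term [wmin j], which is itself invariant. *)
Lemma sum_wenergy_wrefl n j w : j.+1 < n ->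
  \sum_(t < n) wenergy 0 t (wrefl j w) = \sum_(t < n) wenergy 0 t w.
Proof.
move=> jn.
have e v : wenergy 0 j.+1 v = wenergy 0 j (wrefl j v) + wmin j v.
  rewrite /wenergy big_nat_recr //= wbetween_id //; congr (_ + _).
  by apply: eq_big_nat => s /andP[_ sj]; rewrite wbetween_last.
rewrite -!(big_mkord xpredT (fun t => wenergy 0 t _)).
rewrite !(@big_cat_nat _ _ _ j.+2 0 n) //=; congr (_ + _); last first.
  by apply: eq_big_nat => t /andP[jt _]; apply: wenergy_wrefl.
rewrite !(@big_nat_recr _ _ _ j.+1) //= !(@big_nat_recr _ _ _ j) //=.
rewrite !e wreflK wmin_wrefl -!addnA; congr (_ + _); last lia.
apply: eq_big_nat => t /andP[_ tj]; apply: eq_big_nat => s /andP[_ st].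
apply: (@mark_wmin _ (fun x => x < j)); [rewrite /=; lia|rewrite /=; lia|].
apply: mark_wbetween; first by move=> x; lia.
by rewrite mark_wrefl_id //=; lia.
Qed.

(** * Removing a pair of cyclically matched letters *)

Lemma count_wstring i k w : k <= weps i w + wphi i w ->
  count_mem i.+1 (wstring i k w) + weps i w = count_mem i.+1 w + k.
Proof.
elim: w k => [|x u IH] k /=; first lia.
case: (letter2P i x) => [->|->|xi xi1] /= Hk.
- case: ifPn => H; first by have := IH k.+1; rewrite /=; lia.
  case: k Hk => [|k] Hk; first by have := IH 0; rewrite /=; lia.
  by have := IH k; rewrite /= eqxx; lia.
- case: k Hk => [|k] Hk; first by have := IH 0; rewrite /=; lia.
  by have := IH k; rewrite /= eqxx; lia.
by have := IH k; rewrite /= (negPf xi1); lia.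
Qed.

Lemma count_hi_wrefl i w : count_mem i.+1 (wrefl i w) = count_mem i w.
Proof.
have := @count_wstring i (wphi i w) w; have := weps_count i w.
by rewrite -/(wrefl i w); lia.
Qed.

Lemma count_lo_wrefl i w : count_mem i (wrefl i w) = count_mem i.+1 w.
Proof. by have := count_hi_wrefl i (wrefl i w); rewrite wreflK. Qed.

Lemma mark_count x (P : pred nat) u v : P x -> mark P u = mark P v ->
  count_mem x u = count_mem x v.
Proof.
move=> Px; elim: u v => [|y u IH] [|z v] //= [eyz /IH ->]; congr (_ + _).
move: eyz; case: ifP => Py; case: ifP => Pz //; first by case=> ->.
have /negPf -> : y != x by apply: contraFneq Py => ->.
by have /negPf -> : z != x by apply: contraFneq Pz => ->.
Qed.

Lemma count_wrefl_other x i w : x != i -> x != i.+1 ->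
  count_mem x (wrefl i w) = count_mem x w.
Proof.
move=> xi xi1; apply: (@mark_count _ (pred1 x)); first exact: eqxx.
by apply: mark_wrefl_id; rewrite /= eq_sym.
Qed.

Lemma wrefl_fix i w : count_mem i w = count_mem i.+1 w -> wrefl i w = w.
Proof.
move=> e; rewrite /wrefl; have -> : wphi i w = weps i w.
  by have := weps_count i w; lia.
exact: wstring_id.
Qed.

Lemma count_wbetween s t w : s < t ->
  count_mem s.+1 (wbetween s t w) = count_mem t w.
Proof.
move: {2}(t - s) (leqnn (t - s)) => d.
elim: d s => [|d IH] s std st; first lia.
have [->|st1] := eqVneq t s.+1; first by rewrite wbetween_id.
by rewrite wbetween_rec ?count_lo_wrefl ?IH //; lia.
Qed.

(** The energy identity lets [wrefl r] act first; afterwards the letters [r + 1]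
    and [r + 2] are equinumerous where [wrefl r.+1] acts, so it is trivial. *)
Lemma wenergy_step r t w : r < t -> count_mem r w = count_mem t w ->
  wenergy r t w = wmin r w + wenergy r.+1 t (wrefl r w).
Proof.
move=> rt cw; have [e|tr] := eqVneq t r.+1.
  by rewrite e /wenergy big_nat1 big_geq // wbetween_id // addn0.
rewrite -(@wenergy_wrefl r t r) //; last lia.
rewrite /wenergy big_ltn //; congr (_ + _).
rewrite wbetween_rec; last lia.
rewrite wbetween_wrefl // wrefl_fix; last first.
  rewrite count_hi_wrefl count_wrefl_other; [|lia|lia].
  rewrite count_wbetween; last lia.
  rewrite -cw; apply: (@mark_count _ (fun x => x <= r)) => //=.
  by apply: mark_wbetween_id => x; lia.
rewrite wmin_wrefl; apply: (@mark_wmin _ (fun x => x <= r.+1)) => //=.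
by apply: mark_wbetween_id => x; lia.
Qed.

Lemma wenergy_count0 r t w : count_mem t w = 0 -> wenergy r t w = 0.
Proof.
move=> c0; rewrite /wenergy big_nat_cond big1 // => s /andP[/andP[_ st] _].
apply/eqP; rewrite -leqn0 (leq_trans (geq_minl _ _)) //.
by rewrite (leq_trans (weps_le_count _ _)) // count_wbetween // c0.
Qed.

Lemma wmin_rot i k w : k <= size w ->
  wmin i (rot k w) + count_mem i.+1 (take k (wrefl i w)) =
  wmin i w + count_mem i (take k w).
Proof.
elim: k => [|k IH] kw; first by rewrite rot0 !take0.
have {}IH := IH (ltnW kw).
rewrite (rotS kw) (take_nth 0 kw) (take_nth 0) ?size_wrefl //.
rewrite -!cats1 !count_cat /= !addn0.
have nthE v : k < size v -> nth 0 v k = head 0 (rot k v).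
  by move=> kv; rewrite -nth0 /rot nth_cat size_drop subn_gt0 kv nth_drop addn0.
rewrite !nthE ?size_wrefl // -wrefl_rot.
case E : (rot k w) IH => [|x u] IH.
  by move/(congr1 size): E; rewrite size_rot /=; lia.
have [_ h _ _] := wrefl_rcons i x u.
by rewrite rot1_cons /= addnCA h addnA (addnC _ (wmin i _)) IH -addnA.
Qed.

(** [mask b] deletes no letter [i] or [i + 1] of [w]. *)
Definition neutral (i : nat) (b : bitseq) (w : seq nat) : bool :=
  (size b == size w) &&
  all (fun p => p.1 || ((p.2 != i) && (p.2 != i.+1))) (zip b w).

Lemma neutral_cons i c b x w : neutral i (c :: b) (x :: w) =
  (c || (x != i) && (x != i.+1)) && neutral i b w.
Proof. by rewrite /neutral /= eqSS andbCA. Qed.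

Lemma neutral_cat i b1 b2 w1 w2 : size b1 = size w1 ->
  neutral i (b1 ++ b2) (w1 ++ w2) = neutral i b1 w1 && neutral i b2 w2.
Proof.
move=> e; rewrite /neutral !size_cat e eqn_add2l eqxx zip_cat // all_cat /=.
by rewrite andbCA.
Qed.

Lemma neutral_mask i b w : neutral i b w ->
  [/\ weps i (mask b w) = weps i w, wphi i (mask b w) = wphi i w,
    count_mem i (mask b w) = count_mem i w &
    count_mem i.+1 (mask b w) = count_mem i.+1 w].
Proof.
elim: w b => [|x u IH] [|c b] //; rewrite neutral_cons.
case/andP => + /IH[e1 e2 e3 e4]; case: c => /= [_|/andP[xi xi1]].
  by rewrite e1 e2 e3 e4.
by rewrite (negPf xi) (negPf xi1) e1 e2 e3 e4 /= !subn0 addn0.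
Qed.

Lemma neutral_wstring i k b w : neutral i b w ->
  mask b (wstring i k w) = wstring i k (mask b w) /\ neutral i b (wstring i k w).
Proof.
elim: w b k => [|x u IH] [|c b] k //; rewrite neutral_cons => /andP[cx nb].
have [ee _ _ _] := neutral_mask nb.
have IHb k1 := (IH b k1 nb).
case: c cx => /= [_|/andP[xi xi1]]; last first.
  rewrite (negPf xi) (negPf xi1) /= neutral_cons xi xi1.
  by have [-> ->] := IHb k.
rewrite ee; case: ifP => _; first by rewrite neutral_cons /=; have [-> ->] := IHb k.+1.
case: ifP => _; last by rewrite neutral_cons /=; have [-> ->] := IHb k.
case: k => [|k]; rewrite neutral_cons /=; first by have [-> ->] := IHb 0.
by have [-> ->] := IHb k.
Qed.

Lemma weps_cat_nohi i (u v : seq nat) : i.+1 \notin u ->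
  weps i (u ++ v) = weps i v - count_mem i u.
Proof.
elim: u => [|x u IH] /=; first by rewrite subn0.
rewrite inE negb_or => /andP[xi1 /IH ->].
by rewrite eq_sym in xi1; rewrite (negPf xi1) add0n -subnDA (addnC (count_mem i u)).
Qed.

Lemma wphi_cat_nohi i (u v : seq nat) : i.+1 \notin u ->
  wphi i (u ++ v) = wphi i v + (count_mem i u - weps i v).
Proof.
elim: u => [|x u IH] /=; first by rewrite addn0.
rewrite inE negb_or => /andP[_ ui]; rewrite IH // weps_cat_nohi //.
by move: (count_mem i u) (weps i v) (wphi i v) (x == i : nat) => c e p d; lia.
Qed.

Lemma wstring_cat_nohi i k (u v : seq nat) :
  i.+1 \notin u -> count_mem i u <= weps i v ->
  wstring i k (u ++ v) = u ++ wstring i (k + count_mem i u) v.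
Proof.
elim: u k => [|x u IH] k /=; first by rewrite addn0.
rewrite inE negb_or => /andP[xi1 ui]; rewrite weps_cat_nohi //.
rewrite eq_sym in xi1.
case: (eqVneq x i) => [->|xi] cu /=.
  rewrite add1n in cu; rewrite subn_gt0 cu /= IH //; last exact: ltnW.
  by rewrite add1n addSn addnS.
by rewrite (negPf xi1) IH.
Qed.

(** As [i] does not outnumber [i + 1], every [i] in [i :: u] is matched and stays. The displayed
    pair need not be a bracket pair, but with or without it the same number of open [i] enters [v],
    so deleting it does not affect the rest. *)
Lemma wrefl_first_pair i (u v : seq nat) : i.+1 \notin u ->
  count_mem i (i :: u ++ i.+1 :: v) <= count_mem i.+1 (i :: u ++ i.+1 :: v) ->
  exists k, [/\ wrefl i (i :: u ++ i.+1 :: v) = i :: u ++ i.+1 :: wstring i k v,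
    wmin i (i :: u ++ i.+1 :: v) = wmin i (u ++ v) &
    forall c d, neutral i c u -> neutral i d v ->
      wrefl i (mask c u ++ mask d v) = mask c u ++ mask d (wstring i k v)].
Proof.
move=> iu cle; exists (wphi i v + count_mem i u).
have n1 : (i == i.+1) = false by lia.
have n2 : (i.+1 == i) = false by lia.
have iiu : i.+1 \notin i :: u by rewrite inE n2.
have := weps_count i (i :: u ++ i.+1 :: v); rewrite -cat_cons.
rewrite wphi_cat_nohi // weps_cat_nohi // /= eqxx n1 n2 !subn0 !add0n add1n addn0.
move=> wc; have au : count_mem i u <= weps i v.
  move: wc cle; rewrite /= eqxx n1.
  move: (count_mem i (u ++ i.+1 :: v)) (count_mem i.+1 (u ++ i.+1 :: v)).
  by move: (count_mem i u) (weps i v) (wphi i v) => c e p; lia.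
split.
- rewrite -cat_cons /wrefl wphi_cat_nohi // wstring_cat_nohi //; last first.
    by rewrite /= !eqxx n2 !add1n subn0 ltnS.
  have -> : count_mem i (i :: u) - weps i (i.+1 :: v) = 0.
    by apply/eqP; rewrite subn_eq0 /= !eqxx n2 !add1n subn0 ltnS.
  by rewrite /= n2 ?eqxx /= sub0n !addn0 add1n addnS.
- rewrite /wmin -cat_cons !weps_cat_nohi // !wphi_cat_nohi //= !eqxx n2 /=.
  by rewrite !subn0 !add1n addn0 !subSS.
move=> c d nc nd.
have [ec pc cc ch] := neutral_mask nc; have [ed pd cd dh] := neutral_mask nd.
have icu : i.+1 \notin mask c u by apply: contra iu; exact: mem_mask.
have [-> _] := neutral_wstring (wphi i v + count_mem i u) nd.
rewrite /wrefl wphi_cat_nohi // wstring_cat_nohi ?cc ?ed // pd.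
have -> : count_mem i u - weps i v = 0 by apply/eqP; rewrite subn_eq0.
by rewrite addn0.
Qed.

Lemma wrefl_catC i u v u' v' : size u' = size u ->
  wrefl i (v ++ u) = v' ++ u' -> wrefl i (u ++ v) = u' ++ v'.
Proof.
move=> su e; apply: (@rot_inj (size u)); rewrite -wrefl_rot rot_size_cat e.
by rewrite -su rot_size_cat.
Qed.

Lemma wmin_catC i u v u' v' : size u' = size u ->
  wrefl i (v ++ u) = v' ++ u' ->
  wmin i (v ++ u) + count_mem i.+1 u' = wmin i (u ++ v) + count_mem i u.
Proof.
move=> su /(wrefl_catC su) e; have := @wmin_rot i (size u) (u ++ v).
rewrite rot_size_cat e -{2}su !take_size_cat // size_cat.
by move=> -> //; exact: leq_addr.
Qed.

Lemma neutral_size i b w : neutral i b w -> size b = size w.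
Proof. by case/andP => /eqP. Qed.

(** Rotating the chosen [i] to the front reduces this to [wrefl_first_pair]; rotating back changes
    both values of [wmin] equally, since the pair does not straddle the cut. *)
Lemma remove_pair_right i p u v b c d :
  let y := p ++ i :: u ++ i.+1 :: v in let m := b ++ false :: c ++ false :: d in
  i.+1 \notin u -> neutral i b p -> neutral i c u -> neutral i d v ->
  count_mem i y <= count_mem i.+1 y ->
  exists p' v', [/\ size p' = size p, wrefl i y = p' ++ i :: u ++ i.+1 :: v',
    mask m (wrefl i y) = wrefl i (mask m y) & wmin i y = wmin i (mask m y)].
Proof.
move=> y m iu nb nc nd cle.
have sb := neutral_size nb; have sc := neutral_size nc.
have sd := neutral_size nd.
have ndb : neutral i (d ++ b) (v ++ p) by rewrite neutral_cat ?nd.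
have [|k [e1 e2 e3]] := @wrefl_first_pair i u (v ++ p) iu.
  have cE x : count_mem x y = count_mem x (i :: u ++ i.+1 :: v ++ p).
    by rewrite /y count_cat addnC -count_cat /= -catA.
  by rewrite -!cE.
have {}e3 := e3 _ _ nc ndb; have [_ nz] := neutral_wstring k ndb.
move: e1 nz e3; set z := wstring i k _; have sz : size z = size v + size p.
  by rewrite size_wstring size_cat.
have [z1 [z2 [zE sz1 sz2]]] : exists z1 z2,
    [/\ z = z1 ++ z2, size z1 = size v & size z2 = size p].
  exists (take (size v) z), (drop (size v) z).
  by rewrite cat_take_drop size_takel ?size_drop sz ?leq_addr ?addKn.
rewrite {}zE => e1 nz e3.
move: nz; rewrite neutral_cat ?sz1 // => /andP[nd1 nb2].
rewrite !mask_cat ?sz1 // in e3.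
have Y : wrefl i y = z2 ++ i :: u ++ i.+1 :: z1.
  by apply: wrefl_catC => //; rewrite /= -catA /= e1 -catA.
have M0 : mask m y = mask b p ++ mask c u ++ mask d v.
  by rewrite !mask_cat //= mask_cat.
have s2 : size (mask b z2) = size (mask b p) by rewrite !size_mask ?sz2.
have M1 : wrefl i ((mask c u ++ mask d v) ++ mask b p) =
    (mask c u ++ mask d z1) ++ mask b z2 by rewrite -!catA.
exists z2, z1; split=> //.
  by rewrite M0 (wrefl_catC s2 M1) Y !mask_cat ?sz2 //= mask_cat.
have := wmin_catC s2 M1.
have := @wmin_catC i p (i :: u ++ i.+1 :: v) z2 (i :: u ++ i.+1 :: z1) sz2.
rewrite /= -!catA /= => /(_ e1); rewrite M0 e2.
have [_ _ -> _] := neutral_mask nb; have [_ _ _ ->] := neutral_mask nb2.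
rewrite -/y.
have -> : wmin i (u ++ v ++ p) = wmin i (mask c u ++ mask d v ++ mask b p).
  have := neutral_mask (_ : neutral i (c ++ d ++ b) (u ++ v ++ p)).
  rewrite neutral_cat // nc ndb !mask_cat // => /(_ isT) [E1 E2 _ _].
  by rewrite /wmin E1 E2.
by move=> -> /addIn.
Qed.

(** Here the next [i + 1] is reached only by wrapping around: the pair straddles the cut and
    accounts for one unit of [wmin]. *)
Lemma remove_pair_left i p v u b d c :
  let y := p ++ i.+1 :: v ++ i :: u in let m := b ++ false :: d ++ false :: c in
  i.+1 \notin u -> i.+1 \notin p ->
  neutral i b p -> neutral i d v -> neutral i c u ->
  count_mem i y <= count_mem i.+1 y ->
  exists v', [/\ size v' = size v, wrefl i y = p ++ i.+1 :: v' ++ i :: u,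
    mask m (wrefl i y) = wrefl i (mask m y) & wmin i y = (wmin i (mask m y)).+1].
Proof.
move=> y m iu ip nb nd nc cle.
have sb := neutral_size nb; have sc := neutral_size nc.
have sd := neutral_size nd.
have ncb : neutral i (c ++ b) (u ++ p) by rewrite neutral_cat ?nc.
have yE : y = (p ++ i.+1 :: v) ++ i :: u by rewrite /y -catA.
have iup : i.+1 \notin u ++ p by rewrite mem_cat negb_or iu.
have [|k [e1 e2 e3]] := @wrefl_first_pair i (u ++ p) v iup.
  have cE x : count_mem x y = count_mem x (i :: (u ++ p) ++ i.+1 :: v).
    by rewrite yE count_cat addnC -count_cat /= -catA.
  by rewrite -!cE.
have {}e3 := e3 _ _ ncb nd; have [_ nd'] := neutral_wstring k nd.
move: e1 nd' e3; set z := wstring i k _.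
have sz : size z = size v by rewrite size_wstring.
move=> e1 nd' e3; rewrite !mask_cat // in e3.
have s1 : size (p ++ i.+1 :: z) = size (p ++ i.+1 :: v).
  by rewrite !size_cat /= sz.
have e1' : wrefl i ((i :: u) ++ p ++ i.+1 :: v) = (i :: u) ++ p ++ i.+1 :: z.
  by rewrite /= catA e1 -catA.
have Y : wrefl i y = p ++ i.+1 :: z ++ i :: u.
  by rewrite yE (wrefl_catC s1 e1') -catA.
have M0 : mask m y = (mask b p ++ mask d v) ++ mask c u.
  by rewrite !mask_cat //= mask_cat // catA.
have s2 : size (mask b p ++ mask d z) = size (mask b p ++ mask d v).
  by rewrite !size_cat !size_mask ?sz.
have M1 : wrefl i (mask c u ++ mask b p ++ mask d v) =
  mask c u ++ mask b p ++ mask d z by rewrite !catA.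
exists z; split=> //.
  by rewrite M0 (wrefl_catC s2 M1) Y !mask_cat //= mask_cat ?sz // catA.
have := wmin_catC s2 M1; have := wmin_catC s1 e1'.
rewrite M0 -yE /= catA e2 !count_cat /= eqxx.
have [_ _ -> ->] := neutral_mask nb; have [_ _ -> _] := neutral_mask nd.
have [_ _ _ ->] := neutral_mask nd'.
have -> : (i.+1 == i) = false by lia.
have -> : wmin i ((u ++ p) ++ v) = wmin i (mask c u ++ mask b p ++ mask d v).
  have := neutral_mask (_ : neutral i ((c ++ b) ++ d) ((u ++ p) ++ v)).
  rewrite neutral_cat ?ncb ?nd ?size_cat ?sc ?sb // !mask_cat ?size_cat ?sc ?sb //.
  by case=> // E1 E2 _ _; rewrite /wmin catA E1 E2.
rewrite add0n add1n addnS addnS => H1 H2; move: H1; rewrite H2 -addSn => /addIn.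
by [].
Qed.

Lemma neutral_nth i (b : bitseq) (w : seq nat) : size b = size w ->
  (forall p, p < size w -> nth true b p = false ->
     nth 0 w p != i /\ nth 0 w p != i.+1) ->
  neutral i b w.
Proof.
elim: w b => [|x w IH] [|c b] // [sb] H; rewrite neutral_cons.
apply/andP; split; last by apply: IH => // p pw; exact: (H p.+1).
by case: c H => // H; have [//|//|-> ->] := H 0.
Qed.

Lemma neutral_drop_take i (b : bitseq) (w : seq nat) l m : size b = size w ->
  (forall p, l <= p < l + m -> nth true b p = false ->
     nth 0 w p != i /\ nth 0 w p != i.+1) ->
  neutral i (take m (drop l b)) (take m (drop l w)).
Proof.
move=> sb H; apply: neutral_nth; first by rewrite !size_take !size_drop sb.
move=> p pw; have pm : p < m by apply: leq_trans pw _; rewrite size_take_min geq_minl.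
by rewrite !nth_take // !nth_drop; apply: H; lia.
Qed.

Lemma split_nth (T : Type) (x0 : T) w q : q < size w ->
  w = take q w ++ nth x0 w q :: drop q.+1 w.
Proof. by move=> qw; rewrite -drop_nth // cat_take_drop. Qed.

Lemma split_two_nth (T : Type) (x0 : T) w q r : q < r -> r < size w ->
  w = take q (drop 0 w) ++ nth x0 w q :: take (r - q.+1) (drop q.+1 w) ++
      nth x0 w r :: take (size w) (drop r.+1 w).
Proof.
move=> qr rw; rewrite drop0 [take (size w) _]take_oversize; last first.
  by rewrite size_drop leq_subr.
rewrite {1}(@split_nth _ x0 w q); last exact: ltn_trans rw.
congr (_ ++ _ :: _); rewrite {1}(@split_nth _ x0 (drop q.+1 w) (r - q.+1)).
  by rewrite nth_drop subnKC // drop_drop addSn subnK.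
by rewrite size_drop; lia.
Qed.

Lemma notin_take_index (x : nat) w : x \notin take (index x w) w.
Proof.
by elim: w => //= y w IH; case: eqVneq => [->|yx] //=;
  rewrite inE negb_or eq_sym yx.
Qed.

Variant next_pos_spec (w : seq nat) (r p : nat) : nat -> Prop :=
| NextRight q of p <= q & q < size w & nth 0 w q = r
    & r \notin take (q - p) (drop p w) : next_pos_spec w r p q
| NextLeft q of q < p & q < size w & nth 0 w q = r
    & r \notin take q w & r \notin drop p w : next_pos_spec w r p q.

Lemma next_posP w r p : r \in w -> next_pos_spec w r p (next_pos w r p).
Proof.
move=> rw; rewrite /next_pos; case: ifPn => rd.
  have := rd; rewrite -index_mem size_drop => lt.
  apply: NextRight; rewrite ?leq_addr ?addKn ?notin_take_index //.
    by rewrite -ltn_subRL.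
  by rewrite -nth_drop nth_index.
have iw : index r w < size w by rewrite index_mem.
apply: NextLeft => //; [|exact: nth_index|exact: notin_take_index].
rewrite ltnNge; apply: contra rd => pi.
rewrite -(nth_index 0 rw) -(subnKC pi) -nth_drop mem_nth // size_drop; lia.
Qed.

Lemma mark_size P u v : mark P u = mark P v -> size u = size v.
Proof. by move/(congr1 size); rewrite !size_map. Qed.

Lemma mark_nth (P : pred nat) u v p x : mark P u = mark P v -> P x ->
  (nth 0 u p == x) && (p < size u) = (nth 0 v p == x) && (p < size v).
Proof.
move=> e Px; rewrite (mark_size e).
have [pv|] := ltnP p (size v); last by rewrite !andbF.
have pu : p < size u by rewrite (mark_size e).
have /= := congr1 (fun s => nth 0 s p) e; rewrite !(nth_map 0) // !andbT.
case: ifP => P1; case: ifP => P2 //; first by case=> ->.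
by move=> _; apply/idP/idP => /eqP E; [rewrite E Px in P1|rewrite E Px in P2].
Qed.

Lemma mark_next_pos (P : pred nat) u v r p : mark P u = mark P v -> P r ->
  next_pos u r p = next_pos v r p.
Proof.
move=> e Pr.
have idx u1 v1 : mark P u1 = mark P v1 -> index r u1 = index r v1.
  elim: u1 v1 => [|x u1 IH] [|y v1] //= [exy /IH ->].
  have -> // : (x == r) = (y == r).
  move: exy; case: ifP => Px; case: ifP => Py //; first by case=> ->.
  have /negPf -> : x != r by apply: contraFneq Px => ->.
  by have /negPf -> : y != r by apply: contraFneq Py => ->.
have ed : mark P (drop p u) = mark P (drop p v).
  by rewrite /mark !map_drop -/(mark P u) e.
rewrite /next_pos -!index_mem (idx _ _ ed) (idx _ _ e).
by rewrite !size_drop (mark_size e).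
Qed.

(** The two cases of [next_posP] are the two removal lemmas: a wrap of [next_pos] is a removed pair
    that straddles the cut. *)
Lemma remove_pair i y (b : bitseq) q : size b = size y ->
  let q' := next_pos y i.+1 q in
  q < size y -> nth 0 y q = i -> i.+1 \in y ->
  count_mem i y <= count_mem i.+1 y ->
  nth true b q = false -> nth true b q' = false ->
  (forall p, nth true b p = false ->
     (nth 0 y p == i) || (nth 0 y p == i.+1) -> p = q \/ p = q') ->
  [/\ nth 0 (wrefl i y) q = i, nth 0 (wrefl i y) q' = i.+1,
    mask b (wrefl i y) = wrefl i (mask b y) &
    wmin i y = wmin i (mask b y) + (q' < q)].
Proof.
move=> sb q' qy yq iy cle bq bq' H.
have N l m : (forall p, l <= p < l + m -> p <> q /\ p <> q') ->
    neutral i (take m (drop l b)) (take m (drop l y)).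
  move=> lm; apply: neutral_drop_take => // p /lm[pq pq'] bp.
  by apply/andP; rewrite -negb_or; apply/negP => /(H _ bp) [].
move: bq' H N; rewrite /q'; case: next_posP => // {}q'.
- move=> qq' q'y yq' ni bq' H N.
  have {}qq' : q < q'.
    by rewrite ltn_neqAle qq' andbT; apply/eqP => E; move: yq'; rewrite -E yq; lia.
  have := @split_two_nth _ 0 y q q' qq' q'y; rewrite yq yq' => yE.
  have := @split_two_nth _ true b q q' qq'; rewrite bq bq' sb => /(_ q'y) bE.
  have niU : i.+1 \notin take (q' - q.+1) (drop q.+1 y).
    apply: contra ni; rewrite (drop_nth 0 qy) (_ : q' - q = (q' - q.+1).+1); last lia.
    by rewrite /= inE orbC => ->.
  have := @remove_pair_right i _ _ _ _ _ _ niU (N 0 q _) (N q.+1 (q' - q.+1) _)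
    (N q'.+1 (size y) _).
  rewrite /= -yE -bE => /(_ _ _ _ cle)[|p1|p1|p' [v' [sp Y M W]]]; [lia|lia|lia|].
  have sp' : size p' = q by rewrite sp drop0 size_takel // ltnW.
  split=> //; last by rewrite W ltnNge (ltnW qq') addn0.
    by rewrite Y nth_cat sp' ltnn subnn.
  rewrite Y nth_cat sp' ltnNge (ltnW qq') /= (_ : q' - q = (q' - q.+1).+1) /=; last lia.
  by rewrite nth_cat size_takel ?ltnn ?subnn // size_drop; lia.
move=> qq' q'y yq' ni1 ni2 bq' H N.
have := @split_two_nth _ 0 y q' q qq' qy; rewrite yq yq' => yE.
have := @split_two_nth _ true b q' q qq'; rewrite bq bq' sb => /(_ qy) bE.
have niU : i.+1 \notin take (size y) (drop q.+1 y).
  apply: contra ni2; rewrite (drop_nth 0 qy) inE orbC => /mem_take -> //.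
have niP : i.+1 \notin take q' (drop 0 y) by rewrite drop0.
have := @remove_pair_left i _ _ _ _ _ _ niU niP (N 0 q' _) (N q'.+1 (q - q'.+1) _)
    (N q.+1 (size y) _).
rewrite /= -yE -bE => /(_ _ _ _ cle)[|p1|p1|v' [sv Y M W]]; [lia|lia|lia|].
have sp' : size (take q' (drop 0 y)) = q' by rewrite drop0 size_takel // ltnW.
have sv' : size v' = q - q'.+1 by rewrite sv size_takel // size_drop; lia.
split=> //; last by rewrite W qq' addn1.
  rewrite Y nth_cat sp' ltnNge (ltnW qq') /= (_ : q - q' = (q - q'.+1).+1) /=; last lia.
  by rewrite nth_cat sv' ltnn subnn.
by rewrite Y nth_cat sp' ltnn subnn.
Qed.

(** * Dominant words and the extraction of subwords *)

(** [mask b] removes at each level [s] the single letter at position [Q s], and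
    [Q s.+1 < Q s] records a wrap of the removed chain. *)
Lemma wenergy_remove_chain Q t (b : bitseq) r y : r <= t -> size b = size y ->
  Q r < size y -> nth 0 y (Q r) = r ->
  (forall s, r <= s < t -> Q s.+1 = next_pos y s.+1 (Q s)) ->
  (forall s, r <= s <= t -> nth true b (Q s) = false) ->
  (forall p, nth true b p = false -> r <= nth 0 y p <= t -> p = Q (nth 0 y p)) ->
  count_mem r y = count_mem t y ->
  (forall s, r <= s <= t -> count_mem r y <= count_mem s y) ->
  count_mem r (mask b y) = count_mem t (mask b y) ->
  wenergy r t y = wenergy r t (mask b y) + \sum_(r <= s < t) (Q s.+1 < Q s).
Proof.
move: {2}(t - r) (erefl (t - r)) => d.
elim: d r y => [|d IH] r y dE rt sb Qy yQ QS bQ bP cE cle cm.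
  have -> : r = t by lia.
  by rewrite /wenergy !big_geq.
have {}rt : r < t by lia.
have QE := QS r (_ : r <= r < t); rewrite leqnn rt in QE.
have ry : r \in y by rewrite -yQ mem_nth.
have r1y : r.+1 \in y.
  rewrite -has_pred1 has_count; apply: leq_trans (cle r.+1 _); last by rewrite leqnSn.
  by rewrite -has_count has_pred1.
have QS1 : Q r.+1 < size y by rewrite QE //; case: (next_posP (Q r) r1y).
have [|||p bp|n1 n2 M W] := remove_pair sb Qy yQ r1y.
- by apply: cle; rewrite leqnSn.
- by apply: bQ; rewrite leqnn ltnW.
- by rewrite -QE //; apply: bQ; rewrite leqnSn.
- have := bP p bp; rewrite -QE // => H.
  by case/orP => /eqP E; [left|right]; rewrite H ?E ?leqnn ?leqnSn // ltnW.
rewrite -QE // in n2 W.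
have other x s : x \in [:: r; r.+1] = false -> count_mem x (wrefl r s) = count_mem x s.
  by rewrite !inE => /norP[*]; apply: count_wrefl_other.
have tE s : count_mem r s = count_mem t s ->
    count_mem r.+1 (wrefl r s) = count_mem t (wrefl r s).
  move=> ce; have [->|tr] := eqVneq t r.+1; first by [].
  by rewrite count_hi_wrefl other // !inE (negPf tr) orbF; apply/eqP; lia.
(* In [wrefl r y] the letters [r + 1] are as many as the letters [r] were in [y], so the count
   conditions hold again one level up. *)
rewrite (wenergy_step rt cE) (wenergy_step rt cm) -M (IH r.+1 (wrefl r y));
  rewrite ?size_wrefl //; first last.
- by rewrite M; exact: tE.
- move=> s /andP[rs st]; have [<-|sr] := eqVneq r.+1 s; first by [].
  rewrite count_hi_wrefl other; last by rewrite !inE; apply/norP; split; lia.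
  by apply: cle; lia.
- exact: tE.
- move=> p bp /andP[rp pt].
  have pb : p < size y.
    by rewrite -sb ltnNge; apply/negP => /(nth_default true); rewrite bp.
  have [E|N] := eqVneq (nth 0 (wrefl r y) p) r.+1; last first.
    have E : nth 0 y p = nth 0 (wrefl r y) p.
      have := @mark_nth (fun x => r.+1 < x) (wrefl r y) y p (nth 0 (wrefl r y) p).
      rewrite eqxx size_wrefl pb !andbT => H; apply/eqP; rewrite -H //; last lia.
      by apply: mark_wrefl_id; rewrite -leqNgt.
    by rewrite -E; apply: bP => //; rewrite E pt andbT ltnW.
  (* A position showing [r + 1] after the reflection showed [r] or [r + 1] before. The case [r]
     would make it [Q r], which still shows [r]. *)
  have pr : (nth 0 y p == r) || (nth 0 y p == r.+1).
    apply/negPn/negP => /norP[N1 N2].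
    have := @mark_nth (fun x => (x != r) && (x != r.+1)) (wrefl r y) y p (nth 0 y p).
    rewrite eqxx size_wrefl pb !andbT E => H.
    suff : r.+1 == nth 0 y p by rewrite eq_sym (negPf N2).
    by rewrite H /= ?N1 ?N2 // mark_wrefl_id //= eqxx ?andbF.
  rewrite E; case/orP: pr => /eqP pr.
    have pQ : p = Q r by rewrite (bP p bp) pr // leqnn ltnW.
    by move: E; rewrite pQ n1; lia.
  by rewrite {1}(bP p bp) pr // leqnSn.
- by move=> s /andP[rs st]; apply: bQ; rewrite st ltnW.
- move=> s /andP[rs st]; rewrite QS; last by rewrite st ltnW.
  apply: (@mark_next_pos (fun x => r.+1 < x)); last by [].
  by rewrite mark_wrefl_id // -leqNgt.
- lia.
by rewrite [in RHS](big_ltn rt) W; lia.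
Qed.

(** Keeps the [k] leftmost letters 0 and replaces the others by the junk letter
    [N], so that positions do not change. *)
Fixpoint trim (N k : nat) (w : seq nat) : seq nat :=
  if w is x :: u then
    if x == 0 then
      if k is k'.+1 then 0 :: trim N k' u else N :: trim N 0 u
    else x :: trim N k u
  else [::].

Lemma size_trim N k w : size (trim N k w) = size w.
Proof.
by elim: w k => //= x u IH k; case: ifP => _; [case: k => [|k]|]; rewrite /= IH.
Qed.

Lemma mark_trim N k (P : pred nat) w : ~~ P 0 -> ~~ P N ->
  mark P (trim N k w) = mark P w.
Proof.
move=> P0 PN; elim: w k => //= x u IH k.
case: eqVneq => [->|x0] /=; last by rewrite IH.
by case: k => [|k] /=; rewrite (negPf P0) ?(negPf PN) IH.
Qed.

Lemma trim_zeros N k u v : mark (pred1 0) u = mark (pred1 0) v ->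
  mark (pred1 0) (trim N k u) = mark (pred1 0) (trim N k v).
Proof.
elim: u v k => [|x u IH] [|y v] k //= [exy euv].
have xy0 : (x == 0) = (y == 0) by case: (x) exy => [|x']; case: (y) => [|y'].
rewrite xy0; case: (eqVneq y 0) xy0 => [_ _|y0 x0] /=; last first.
  by rewrite (IH v) // x0 (negPf y0).
by case: k => [|k] /=; rewrite (IH v).
Qed.

Lemma count0_trim N k w : 0 < N -> count_mem 0 (trim N k w) = minn k (count_mem 0 w).
Proof.
move=> N0; elim: w k => [|x u IH] k /=; first by rewrite minn0.
case: (eqVneq x 0) => [_|x0] /=; last by rewrite (negPf x0) IH.
case: k => [|k] /=; rewrite IH; last by rewrite !add1n minnSS.
by rewrite !min0n; case: N N0 {IH}.
Qed.

(** [weps 0] is the largest excess of letters [1] over letters [0] in a prefix. A prefix with at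
    most [k] letters [0] keeps its excess; any other has, after trimming, at most the number of
    letters [1] minus [k]. *)
Lemma weps0_trim N k (w : seq nat) : 1 < N ->
  weps 0 w <= weps 0 (trim N k w) <= maxn (weps 0 w) (count_mem 1 w - k).
Proof.
move=> N1.
have c1 k' (u : seq nat) : count_mem 1 (trim N k' u) = count_mem 1 u.
  by apply: (@mark_count 1 (pred1 1)) => //; apply: mark_trim => //=; lia.
elim: w k => [|x u IH] k //=.
case: (eqVneq x 0) => [x0|x0] /=; last first.
  by rewrite (negPf x0); have := IH k; move: (count_mem 1 u) => c; lia.
rewrite {}x0; case: k => [|k] /=; last first.
  by have := IH k; move: (count_mem 1 u) => c; lia.
have := IH 0; have := weps_le_count 0 (trim N 0 u); rewrite c1.
have -> : (N == 0) = false by lia.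
have -> : (N == 1) = false by lia.
by move: (count_mem 1 u) => c; lia.
Qed.

(** Only the term [s = 0] sees the letters [0]. There the word [z] has [k] letters [1] and at least
    [k] letters [0], so [wmin 0] equals [weps 0] before and after trimming, and [weps0_trim] shows
    that it is unchanged. *)
Lemma wenergy_trim N k t w : t < N -> count_mem t w = k -> k <= count_mem 0 w ->
  wenergy 0 t (trim N k w) = wenergy 0 t w.
Proof.
case: t => [|t] tN ct c0; first by rewrite /wenergy !big_geq.
rewrite /wenergy !(@big_ltn _ _ _ 0) //; congr (_ + _); last first.
  apply: eq_big_nat => s /andP[s0 st].
  apply: (@mark_wmin _ (fun x => 0 < x < N)); [lia|lia|].
  by apply: mark_wbetween => [x|]; [lia|apply: mark_trim; rewrite ?ltnn ?andbF].
set z := wbetween 0 t.+1 w.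
have cz1 : count_mem 1 z = k by rewrite count_wbetween.
have cz0 : count_mem 0 z = count_mem 0 w.
  apply: (@mark_count _ (pred1 0)) => //.
  by apply: mark_wbetween_id => x /=; lia.
transitivity (wmin 0 (trim N k z)).
  apply: (@mark_wmin _ (fun x => x <= t.+1)) => //.
  apply: (@mark_union (pred1 0) (fun x => 0 < x < N)); first by move=> x /=; lia.
    rewrite mark_wbetween_id; last by move=> x /=; lia.
    apply/esym/trim_zeros.
    by rewrite mark_wbetween_id // => x /=; lia.
  rewrite [RHS]mark_trim ?ltnn ?andbF //; apply: mark_wbetween; first by lia.
  by apply: mark_trim; rewrite ?ltnn ?andbF.
have tz : count_mem 1 (trim N k z) = k.
  rewrite -cz1; apply: (@mark_count 1 (pred1 1)) => //.
  by apply: mark_trim => //=; lia.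
have := weps_count 0 z; have := weps_count 0 (trim N k z).
rewrite count0_trim ?tz ?cz1 ?cz0 //; last by lia.
have := @weps0_trim N k z; rewrite cz1 subnn maxn0.
by rewrite /wmin; move: (count_mem 0 w) c0 => c c0 H; have := H (_ : 1 < N); lia.
Qed.

Definition dominant_word (w : seq nat) : Prop :=
  forall j, count_mem j.+1 w <= count_mem j w.

Lemma dominant_word_le w i j : dominant_word w -> i <= j ->
  count_mem j w <= count_mem i w.
Proof.
move=> dw; elim: j => [|j IH]; first by rewrite leqn0 => /eqP ->.
rewrite leq_eqVlt => /orP[/eqP -> //|]; rewrite ltnS => /IH.
exact: leq_trans.
Qed.

(** Decreasing multiplicities force the letters to form an initial segment, whose length is the
    number of letters that [selection] extracts. *)
Lemma dominant_word_mem w s : dominant_word w ->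
  (s \in w) = (s < size (undup w)).
Proof.
move=> dw; have ex : exists m, m \notin w.
  exists (\max_(x <- w) x).+1; apply/negP => H.
  by have := @leq_bigmax_seq _ _ xpredT (fun x => x) _ H isT; rewrite ltnn.
have mE : forall x, (x \in w) = (x < ex_minn ex).
  move=> x; case: ex_minnP => m mw mmin; case: ltnP => xm.
    by apply/negPn/negP => /mmin; rewrite leqNgt xm.
  apply/negP; rewrite -has_pred1 has_count => cx.
  have := leq_trans cx (dominant_word_le dw xm).
  by rewrite -has_count has_pred1 (negPf mw).
rewrite mE; congr (_ < _); rewrite -(size_iota 0 (ex_minn ex)).
apply/perm_size/uniq_perm; rewrite ?iota_uniq ?undup_uniq // => x.
by rewrite mem_undup mem_iota mE.
Qed.

Lemma count_mask_negb (a : pred nat) b w : size b = size w ->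
  count a (mask b w) + count a (mask (map negb b) w) = count a w.
Proof.
elim: w b => [|x w IH] [|c b] //= [/IH <-].
by case: c => /=; [rewrite addnA|rewrite addnCA].
Qed.

Lemma size_sel_pos w r p m : size (sel_pos w r p m) = m.
Proof. by elim: m r p => //= m IH r p; rewrite IH. Qed.

Lemma nth_sel_posS w r p m s : s.+1 < m ->
  nth 0 (sel_pos w r p m) s.+1 =
  next_pos w (r + s.+1) (nth 0 (sel_pos w r p m) s).
Proof.
elim: m r p s => [//|m IH] r p [|s] /= sm; last first.
  by rewrite IH // addSnnS.
by case: m sm {IH} => [//|m] _; rewrite /= addn1.
Qed.

Lemma index_map_in (g : nat -> nat) F x : x \in F -> {in F &, injective g} ->
  index (g x) (map g F) = index x F.
Proof.
elim: F => //= y F IH; rewrite inE => xF ig.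
have -> : (g y == g x) = (y == x).
  apply/eqP/eqP => [|-> //]; apply: ig; rewrite ?inE ?eqxx //.
case: eqVneq xF => //= yx xF.
by rewrite IH // => a b aF bF; apply: ig; rewrite inE ?aF ?bF orbT.
Qed.

Lemma index_sorted_ltn F x y : sorted ltn F -> x \in F -> y \in F ->
  (index x F < index y F) = (x < y).
Proof.
move=> sF xF yF; have H := sorted_ltn_index ltn_trans sF.
apply/idP/idP => [|xy]; first exact: H.
rewrite ltnNge; apply/negP; rewrite leq_eqVlt => /orP[/eqP /index_inj E|/H].
  by move: xy; rewrite E // ltnn.
by move=> /(_ yF xF) /(ltn_trans xy); rewrite ltnn.
Qed.

Lemma charge_indexE v r :
  charge_index v r = \sum_(0 <= s < r) (index s.+1 v < index s v).
Proof.
by elim: r => [|r IH] /=; [rewrite big_geq|rewrite big_nat_recr //= IH].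
Qed.

Lemma nth_trim N k w p : nth 0 w p != 0 -> nth 0 (trim N k w) p = nth 0 w p.
Proof.
elim: w k p => [|x u IH] k p //=; case: (eqVneq x 0) => [->|x0]; last first.
  by case: p => //= p; apply: IH.
by case: k => [|k]; case: p => //= p; apply: IH.
Qed.

Lemma nth_trim_first N k w : 0 \in w -> 0 < k -> nth 0 (trim N k w) (index 0 w) = 0.
Proof.
move=> + k0; elim: w => //= x u IH; rewrite inE eq_sym.
by case: eqVneq => //=; case: k k0 {IH}.
Qed.

Lemma trim_mask N k (b : bitseq) w : size b = size w ->
  (forall p, nth true b p = false -> nth 0 w p <> 0) ->
  mask b (trim N k w) = trim N k (mask b w).
Proof.
elim: w k b => [|x u IH] k [|c b] // [sb] H.
have {}IH k' := IH k' b sb (fun p => H p.+1).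
case: c H => H /=; last first.
  have -> : (x == 0) = false by apply/eqP; exact: (H 0 erefl).
  by rewrite /= IH.
by case: ifP => _; [case: k => [|k]|]; rewrite /= IH.
Qed.

Lemma trim_mask_first N k (b : bitseq) w : size b = size w -> 0 < k ->
  nth true b (index 0 w) = false ->
  (forall p, nth true b p = false -> nth 0 w p = 0 -> p = index 0 w) ->
  0 \in w ->
  mask b (trim N k w) = trim N k.-1 (mask b w).
Proof.
move=> + k0; elim: w b => [|x u IH] [|c b] // [sb] /=.
case: eqVneq => [->|x0] /= cE H; rewrite inE.
  move=> _; move: cE H => -> H; case: k k0 {IH} => // k _ /=.
  by apply: trim_mask => // p bp up; have := H p.+1 bp up.
rewrite eq_sym (negPf x0) /= => u0.
have e := IH b sb cE (fun p bp up => succn_inj (H p.+1 bp up)) u0.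
by case: c H => _ /=; rewrite ?(negPf x0) e.
Qed.

Lemma std_charge_perm v m : perm_eq v (iota 0 m) ->
  std_charge v = \sum_(0 <= t < m) \sum_(0 <= s < t) (index s.+1 v < index s v).
Proof.
move=> /perm_size; rewrite size_iota => vm.
rewrite /std_charge vm -(big_mkord xpredT (charge_index v)).
by apply: eq_bigr => t _; exact: charge_indexE.
Qed.

(** Describes the extraction by the positions [Q s] of its letters. Extraction keeps the order of
    positions, so the charge index increases at [s + 1] exactly when the chain wraps. *)
Lemma selectionP w : dominant_word w -> let m := size (undup w) in
  let b := map negb (selection w) in
  exists Q : nat -> nat,
  [/\ forall s, s < m -> Q s < size w /\ nth 0 w (Q s) = s,
    0 < m -> Q 0 = index 0 w,
    forall s, s.+1 < m -> Q s.+1 = next_pos w s.+1 (Q s),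
    (forall p, nth true b p = false <-> exists2 s, s < m & p = Q s) &
    perm_eq (mask (selection w) w) (iota 0 m) /\
    std_charge (mask (selection w) w) =
      \sum_(0 <= t < m) \sum_(0 <= s < t) (Q s.+1 < Q s)].
Proof.
move=> dw m b; pose ps := sel_pos w 0 0 m; pose Q s := nth 0 ps s; exists Q.
have sps : size ps = m by exact: size_sel_pos.
have memE s : (s \in w) = (s < m) := dominant_word_mem s dw.
have QS s : s.+1 < m -> Q s.+1 = next_pos w s.+1 (Q s).
  by move=> sm; rewrite /Q nth_sel_posS.
have Q0 : 0 < m -> Q 0 = index 0 w.
  rewrite /Q /ps -memE => w0; have : 0 < m by rewrite -memE.
  by case: (m) => //= m' _; rewrite /next_pos drop0 w0.
have QP s : s < m -> Q s < size w /\ nth 0 w (Q s) = s.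
  case: s => [|s] sm; first by rewrite Q0 // index_mem nth_index // memE.
  rewrite QS //; move: sm; rewrite -memE => sw.
  by case: (next_posP (Q s) sw).
have psP p : reflect (exists2 s, s < m & p = Q s) (p \in ps).
  apply: (iffP (nthP 0)) => -[s]; rewrite sps => sm e; exists s => //.
have bP p : nth true b p = false <-> exists2 s, s < m & p = Q s.
  have [pw|wp] := ltnP p (size w); last first.
    rewrite nth_default ?size_map ?size_iota //; split=> // -[s /QP[+ _] E].
    by rewrite -E ltnNge wp.
  rewrite (nth_map false) ?size_map ?size_iota // (nth_map 0) ?size_iota //.
  rewrite nth_iota // add0n; split=> [/negbFE /psP //|H].
  by apply/negbF/psP.
pose F := [seq q <- iota 0 (size w) | q \in ps].
have vE : mask (selection w) w = [seq nth 0 w q | q <- F].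
  rewrite /F filter_mask map_mask; congr mask.
  by rewrite -[LHS](mkseq_nth 0).
have FP q : q \in F = (q \in ps).
  rewrite mem_filter mem_iota andb_idr // => /psP[s /QP[sw _] ->].
  by rewrite sw.
have QF s : s < m -> Q s \in F by move=> sm; rewrite FP; apply/psP; exists s.
have ginj : {in F &, injective (nth 0 w)}.
  move=> q r; rewrite !FP => /psP[s sm ->] /psP[s' sm' ->].
  by rewrite (QP s sm).2 (QP s' sm').2 => ->.
have pv : perm_eq (mask (selection w) w) (iota 0 m).
  apply: uniq_perm; rewrite ?iota_uniq //.
    by rewrite vE map_inj_in_uniq ?filter_uniq ?iota_uniq.
  move=> x; rewrite vE mem_iota add0n; apply/mapP/idP => [[q]|xm].
    by rewrite FP => /psP[s sm ->] ->; rewrite (QP s sm).2.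
  by exists (Q x); rewrite ?QF // (QP x xm).2.
split=> //; split=> //; rewrite (std_charge_perm pv).
apply: eq_big_nat => t /andP[_ tm]; apply: eq_big_nat => s /andP[_ st].
have sm : s < m by exact: ltn_trans tm.
have sm1 : s.+1 < m by exact: leq_ltn_trans tm.
have idx r : r < m -> index r (mask (selection w) w) = index (Q r) F.
  by move=> rm; rewrite vE -{1}(QP r rm).2 index_map_in ?QF.
rewrite !idx // index_sorted_ltn ?QF //.
by apply: sorted_filter; [exact: ltn_trans | exact: iota_ltn_sorted].
Qed.

(** Induction on the extraction rounds: a round removes one copy of each letter present, hence
    preserves dominance, and level by level its charge is the drop of the energy. *)
Lemma ls_charge_wenergy n w : all (fun x => x < n) w -> dominant_word w ->
  ls_charge w = \sum_(t < n) wenergy 0 t w.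
Proof.
rewrite /ls_charge => wn dw; move: (leqnn (size w)) wn dw.
move: {2 3}(size w) => k; elim: k w => [|k IH] w sw wn dw.
  move: sw; rewrite leqn0 => /nilP ->.
  by rewrite big1 // => t _; rewrite wenergy_count0.
have [w0|wN0] := eqVneq w [::].
  by rewrite w0 big1 // => t _; rewrite wenergy_count0.
have [Q [QP Q0 QS bP [pv sv]]] := selectionP dw.
set m := size (undup w) in QP Q0 QS bP pv sv.
set b := map negb (selection w) in bP.
have memE s : (s \in w) = (s < m) := dominant_word_mem s dw.
have ssel : size (selection w) = size w by rewrite size_map size_iota.
have sb : size b = size w by rewrite size_map.
have m0 : 0 < m.
  have [x] : exists x, x \in w.
    by case: (w) wN0 => // x u _; exists x; exact: mem_head.
  by rewrite memE; exact: leq_ltn_trans.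
have cr x : count_mem x (mask b w) = count_mem x w - (x < m).
  have := count_mask_negb (pred1 x) ssel; rewrite -/b (permP pv) => <-.
  by rewrite (count_uniq_mem _ (iota_uniq 0 m)) mem_iota /= add0n addKn.
have -> : charge_rec k.+1 w =
    std_charge (mask (selection w) w) + charge_rec k (mask b w).
  by rewrite /b; case: (w) wN0.
have cpos x : x < m -> 0 < count_mem x w by rewrite -memE -has_pred1 has_count.
have c0 x : m <= x -> count_mem x w = 0.
  by move=> mx; apply/count_memPn; rewrite memE -leqNgt.
rewrite IH; first last.
- move=> j; rewrite !cr; have := dw j; case: (ltnP j.+1 m) => jm.
    by rewrite (ltn_trans (ltnSn j) jm) => ?; apply: leq_sub2r.
  by rewrite (c0 j.+1 jm).
- by apply/allP => x /mem_mask; exact: (allP wn).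
- rewrite -ltnS; apply: leq_trans sw.
  have := count_mask_negb predT ssel.
  rewrite !count_predT -/b (perm_size pv) size_iota => <-.
  by rewrite -[ltnLHS]add0n ltn_add2r.
rewrite sv -!(big_mkord xpredT (fun t => wenergy 0 t _)).
have mn : m <= n.
  case: (m) m0 memE => // m' _ memE; have := memE m'; rewrite ltnSn.
  by move/(allP wn).
rewrite !(@big_cat_nat _ _ _ m 0 n) //= addnA; congr (_ + _); last first.
  apply: eq_big_nat => t /andP[mt _].
  by rewrite !wenergy_count0 // ?cr c0.
rewrite -big_split; apply: eq_big_nat => t /andP[_ tm] /=.
(* The junk letter lies above every letter on which [wenergy 0 t] depends. Keeping [kt] letters [0]
   makes them as many as the letters [t], as [wenergy_remove_chain] requires. *)
pose N := t.+2; pose kt := count_mem t w.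
have kt0 : 0 < kt by exact: cpos.
have ktle s : s <= t -> kt <= count_mem s w by exact: dominant_word_le.
have w0 : 0 \in w by rewrite memE.
(* The extracted [0] is the leftmost one, hence among those kept; after its removal one fewer is to
   be kept. *)
have maskE : mask b (trim N kt w) = trim N kt.-1 (mask b w).
  apply: trim_mask_first => //; first by rewrite -Q0 //; apply/bP; exists 0.
  by move=> p /bP[s sm ->]; rewrite (QP s sm).2 => s0; rewrite s0 Q0.
have cm0 : kt.-1 <= count_mem 0 (mask b w).
  by rewrite cr m0 -subn1; apply: leq_sub2r; exact: ktle.
have cmt : count_mem t (mask b w) = kt.-1 by rewrite cr tm subn1.
rewrite -(@wenergy_trim N kt t w) ?ktle //.
rewrite -(@wenergy_trim N kt.-1 t (mask b w)) // -maskE addnC.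
have ctrim s u j : 0 < s <= t -> count_mem s (trim N j u) = count_mem s u.
  move=> st; apply: (@mark_count s (fun x => 0 < x <= t)) => //.
  by apply: mark_trim; rewrite /N //=; lia.
have cy0 : count_mem 0 (trim N kt w) = kt.
  by rewrite count0_trim //; apply/minn_idPl/ktle.
symmetry; apply: wenergy_remove_chain => //; rewrite ?size_trim //.
- by have [] := QP 0 m0.
- by rewrite Q0 // nth_trim_first.
- move=> s /andP[_ st]; rewrite QS; last exact: leq_ltn_trans tm.
  apply/esym; apply: (@mark_next_pos (fun x => 0 < x <= t)); last by [].
  by apply: mark_trim; rewrite /N //=; lia.
- by move=> s /andP[_ st]; apply/bP; exists s => //; exact: leq_ltn_trans tm.
- move=> p /bP[s sm ->] _; case: s sm => [|s] sm.
    by rewrite Q0 // nth_trim_first // Q0.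
  by rewrite nth_trim (QP _ sm).2.
- rewrite cy0; case: (posnP t) => [->|t0]; first by rewrite cy0.
  by rewrite ctrim // t0 leqnn.
- move=> s /andP[_ st]; rewrite cy0; case: (posnP s) => [->|s0]; first by rewrite cy0.
  by rewrite ctrim ?s0 // ktle.
rewrite maskE count0_trim // (minn_idPl cm0).
case: (posnP t) => [t0|t0]; first by rewrite t0 count0_trim // (minn_idPl cm0).
by rewrite ctrim ?t0 ?leqnn // cmt.
Qed.

(** * Letter sums and alphabets along an orbit of words *)

Lemma sumn_wstring i k w : k <= weps i w + wphi i w ->
  sumn (wstring i k w) + weps i w = sumn w + k.
Proof.
elim: w k => [|x u IH] k /=; first lia.
case: (letter2P i x) => [->|->|xi xi1] /= Hk.
- case: ifPn => H; first by have := IH k.+1; rewrite /=; lia.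
  case: k Hk => [|k] Hk; first by have := IH 0; rewrite /=; lia.
  by have := IH k; rewrite /=; lia.
- case: k Hk => [|k] Hk; first by have := IH 0; rewrite /=; lia.
  by have := IH k; rewrite /=; lia.
by have := IH k; rewrite /=; lia.
Qed.

Lemma all_wrefl n j w : j.+1 < n ->
  all (fun x => x < n) w -> all (fun x => x < n) (wrefl j w).
Proof.
move=> jn /allP wn; apply/allP => x; rewrite -has_pred1 has_count.
have [->|xj] := eqVneq x j; first by move=> _; exact: ltnW.
have [->|xj1] := eqVneq x j.+1; first by [].
by rewrite count_wrefl_other // -has_count has_pred1 => /wn.
Qed.

Lemma sum_wenergy_foldr n w s : all (fun j => j.+1 < n) s ->
  \sum_(t < n) wenergy 0 t (foldr wrefl w s) = \sum_(t < n) wenergy 0 t w.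
Proof.
by elim: s => //= j s IH /andP[jn /IH <-]; exact: sum_wenergy_wrefl.
Qed.

Lemma all_foldr_wrefl n w s : all (fun j => j.+1 < n) s ->
  all (fun x => x < n) w -> all (fun x => x < n) (foldr wrefl w s).
Proof.
by move=> + wn; elim: s => //= j s IH /andP[jn /IH]; exact: all_wrefl.
Qed.

End Words.

(** * Crystals modelled by words *)

Lemma all_ord n (s : seq 'I_n.-1) :
  all (fun j => (j.+1 < n)%N) [seq val j | j <- s].
Proof. by apply/allP => x /mapP[j _ ->]; exact: (hi_proof j). Qed.

(** On the part [P] of [B], [rho] is a strict crystal morphism to words; weights
    need to match only up to a constant vector. *)
Definition word_model n (B : crystal_data n) (P : B -> Prop)
    (rho : B -> seq nat) : Prop :=
  forall j x, P x ->
  [/\ coroot j (wt x) = (count_mem (j : nat) (rho x))%:Z -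
        (count_mem j.+1 (rho x))%:Z,
    we j (rho x) = omap rho (ce j x), wf j (rho x) = omap rho (cf j x),
    (forall y, ce j x = Some y -> P y) & (forall y, cf j x = Some y -> P y)].

Lemma word_model_iter_f n (B : crystal_data n) P rho (HP : word_model P rho)
    (j : 'I_n.-1) (x : B) m :
  P x -> (m <= wphi j (rho x))%N ->
  exists y, [/\ iter m (obind (cf j)) (Some x) = Some y, P y &
     rho y = wstring j (weps j (rho x) + m) (rho x)].
Proof.
move=> Px; elim: m => [|m IH] mp; first by exists x; rewrite addn0 wstring_id.
have [y [e Py ry]] := IH (ltnW mp); have [_ _ cfE _ cfP] := HP j y Py.
move: cfE; rewrite wfE ry wphi_wstring; last lia.
rewrite weps_wstring; last lia.
rewrite ifT; last lia.
rewrite wstring_wstring; [|lia|lia].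
case cy : (cf j y) => [z|] //= [ez]; exists z.
by rewrite e /= cy -ez addnS; split=> //; exact: cfP cy.
Qed.

Lemma word_model_iter_e n (B : crystal_data n) P rho (HP : word_model P rho)
    (j : 'I_n.-1) (x : B) m :
  P x -> (m <= weps j (rho x))%N ->
  exists y, [/\ iter m (obind (ce j)) (Some x) = Some y, P y &
     rho y = wstring j (weps j (rho x) - m) (rho x)].
Proof.
move=> Px; elim: m => [|m IH] mp; first by exists x; rewrite subn0 wstring_id.
have [y [e Py ry]] := IH (ltnW mp); have [_ ceE _ ceP _] := HP j y Py.
move: ceE; rewrite weE ry weps_wstring; last lia.
rewrite -(subnSK mp) wstring_wstring; [|lia|lia].
case cy : (ce j y) => [z|] //= [ez]; exists z.
by rewrite e /= cy -ez; split=> //; exact: ceP cy.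
Qed.

(** The number of steps is the difference of [wphi] and [weps], at most the length of the string in
    that direction, so the default of [odflt] is never taken. *)
Lemma word_model_weyl n (B : crystal_data n) P rho (HP : word_model P rho)
    (j : 'I_n.-1) (x : B) :
  P x -> P (weyl j x) /\ rho (weyl j x) = wrefl j (rho x).
Proof.
move=> Px; have [cor _ _ _ _] := HP j x Px.
have wc := weps_count j (rho x); rewrite /weyl.
move: cor wc; move: (count_mem _ _) (count_mem _ _) => a c.
set k := coroot j (wt x) => cor wc; case: ifPn => k0.
  have [|y [-> Py /= ->]] := word_model_iter_f HP (j := j) (m := `|k|%N) Px.
    by lia.
  by split=> //; rewrite /wrefl; congr (wstring j _ _); lia.
have [|y [-> Py /= ->]] := word_model_iter_e HP (j := j) (m := `|k|%N) Px.
  by lia.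
by split=> //; rewrite /wrefl; congr (wstring j _ _); lia.
Qed.

Lemma word_model_foldr n (B : crystal_data n) P rho (HP : word_model P rho)
    (x : B) (s : seq 'I_n.-1) :
  P x -> P (foldr (@weyl n B) x s) /\
  rho (foldr (@weyl n B) x s) = foldr wrefl (rho x) [seq val j | j <- s].
Proof.
move=> Px; elim: s => [|j s [Ps IH]] //=.
by have [Pj ->] := word_model_weyl HP j Ps; rewrite IH.
Qed.

(** * Tableaux and connected components as word models *)

Lemma size_reading T : size (reading T) = sumn (shape T).
Proof.
rewrite size_flatten /shape -map_comp; congr sumn.
by apply: eq_map => r /=; rewrite size_rev.
Qed.

Lemma unreadingK mu w : size w = sumn mu -> reading (unreading mu w) = w.
Proof.
move=> sw; rewrite /reading /unreading -map_comp.
rewrite (eq_map (g := id)) ?map_id ?reshapeKr ?sw // => r /=; exact: revK.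
Qed.

Lemma size_we i w w' : we i w = Some w' -> size w' = size w.
Proof. by rewrite weE; case: (weps i w) => // k [<-]; rewrite size_wstring. Qed.

Lemma size_wf i w w' : wf i w = Some w' -> size w' = size w.
Proof. by rewrite wfE; case: ifP => // _ [<-]; rewrite size_wstring. Qed.

Lemma tableaux_model n : @word_model n (tableaux n) (fun=> True) reading.
Proof.
move=> j T _; split=> //.
- by rewrite /coroot !mxE.
- rewrite /=; case E : (we j (reading T)) => [w|] //=.
  by rewrite unreadingK // (size_we E) size_reading.
rewrite /=; case E : (wf j (reading T)) => [w|] //=.
by rewrite unreadingK // (size_wf E) size_reading.
Qed.

(** Coroots do not see the constant translation by [d], and a connected component is closed under
    the operators. *)
Lemma identifies_model n (B : crystal n) (b : B) l d psi :
  identifies b l d psi -> word_model (connected b) (reading \o psi).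
Proof.
move=> I j x bx; have [cor ceE cfE _ _] := @tableaux_model n j (psi x) Logic.I.
split.
- by rewrite -cor (id_wt I) // /coroot !mxE opprD addrACA subrr addr0.
- by rewrite /= ceE (id_ce I) //; case: (ce j x).
- by rewrite /= cfE (id_cf I) //; case: (cf j x).
- move=> y /cf_ce xy; apply: rst_trans bx _.
  by apply: rst_sym; apply: rst_step; exists j.
- by move=> y xy; apply: rst_trans bx _; apply: rst_step; exists j.
Qed.

(** If [j + 1] outnumbers [j], reflecting turns the surplus into letters [j] and lowers the sum of
    the letters, so the descent ends at a dominant weight. *)
Lemma dominant_in_orbit n (T : tableaux n) :
  exists2 T' : tableaux n, Defs.in_orbit T T' & dominant (wt T').
Proof.
have [k] := ubnP (sumn (reading T)); elim: k T => // k IH T Tk.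
have [/forallP D|/forallPn[j]] :=
  boolP [forall j : 'I_n.-1, wt T 0 (hi j) <= wt T 0 (lo j)].
  by exists T => //; exists [::].
rewrite -ltNge => jT.
have [_ rE] := word_model_weyl (@tableaux_model n) j (x := T) Logic.I.
have [|T' [s ->] D] := IH (weyl j T).
  rewrite rE; have := @sumn_wstring j (wphi j (reading T)) (reading T).
  have := weps_count j (reading T); rewrite -/(wrefl j (reading T)).
  by move: jT; rewrite !mxE /=; move: (count_mem _ _) (count_mem _ _) => a c; lia.
exists (foldr (@weyl n _) (weyl j T) s) => //.
by exists (rcons s j); rewrite foldr_rcons.
Qed.

(** * The sum over positive roots in terms of words *)

Lemma map_val_filter_enum n s t : (t < n)%N ->
  [seq val j | j <- [seq j : 'I_n.-1 <- enum 'I_n.-1 | (s < j < t)%N]] =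
  iota s.+1 (t - s.+1).
Proof.
move=> tn; rewrite -(filter_map val (fun j => s < j < t)%N) val_enum_ord.
apply: (irr_sorted_eq ltn_trans ltnn).
- by apply: sorted_filter; [exact: ltn_trans | exact: iota_ltn_sorted].
- exact: iota_ltn_sorted.
by move=> x; rewrite mem_filter !mem_iota; lia.
Qed.

Lemma sum_roots_wenergy n (B : crystal n) (b : B) l d psi :
  identifies b l d psi ->
  \sum_(a : 'I_n.-1 * 'I_n | (a.1 < a.2)%N)
    Num.min (eps_root a b) (phi_root a b) =
  (\sum_(t < n) wenergy 0 t (reading (psi b)))%N%:Z.
Proof.
move=> I; have bb : connected b b by exact: rst_refl.
pose w := reading (psi b).
have E (a : 'I_n.-1 * 'I_n) : Num.min (eps_root a b) (phi_root a b) =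
    (wmin a.1 (wbetween a.1 a.2 w))%:Z.
  have [Pa rE] := word_model_foldr (identifies_model I)
    [seq j : 'I_n.-1 <- enum 'I_n.-1 | (a.1 < j < a.2)%N] bb.
  rewrite map_val_filter_enum // in rE.
  rewrite /eps_root /phi_root /weyl_between -(id_eps I) // -(id_phi I) //.
  move: rE; rewrite /= => ->; rewrite /wmin.
  by rewrite minElt ltz_nat /minn; case: ifP.
rewrite (eq_bigr _ (fun a _ => E a)) -(big_morph Posz PoszD (erefl 0%:Z)).
congr Posz; rewrite -(pair_big_dep xpredT (fun (s : 'I_n.-1) (t : 'I_n) => (s < t)%N)
  (fun s t => wmin s (wbetween s t w))) /=.
rewrite (exchange_big_dep xpredT) //=; apply: eq_bigr => t _.
(* Since [t < n], every [s < t] is a node. *)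
rewrite /wenergy big_mkord (big_ord_widen n.-1 (fun s => wmin s (wbetween s t w))) //.
by rewrite -ltnS prednK //; case: t => /= t; lia.
Qed.

Unset Implicit Arguments.

Theorem theorem3p2 (n : nat) (B : crystal n) (B_regular : regular B) (b : B) :
  (charge b)%:Z =
  \sum_(a : 'I_n.-1 * 'I_n | (a.1 < a.2)%N)
    Num.min (eps_root a b) (phi_root a b).
Proof.
have [l [d [psi [dl I]]]] := B_regular b.
have [T' TT' dT'] := dominant_in_orbit (psi b).
(* Existence of some charge keeps [xget] off its default [0]. The data chosen so far are then
   dropped in favour of those that define [charge b]. *)
have : is_charge b (charge b).
  apply: (@xgetPex _ 0%N [set c | is_charge b c]%classic).
  by exists (tableau_charge T'), l, d, psi, T'.
move=> {l d psi dl I T' TT' dT'} [l [d [psi [T' [_ I [s ->] dT' ->]]]]].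
rewrite (sum_roots_wenergy I) /tableau_charge; congr Posz.
have [_ rE] := word_model_foldr (@tableaux_model n) s (x := psi b) Logic.I.
have wn : all (fun x => (x < n)%N) (reading (psi b)).
  have /and4P[_ _ _ /allP Tn] := id_sst I (rst_refl _ _ b).
  apply/allP => x /flattenP[_ /mapP[r rT ->]]; rewrite mem_rev => xr.
  exact: (allP (Tn r rT)).
have wn' := all_foldr_wrefl (all_ord s) wn; rewrite -rE in wn'.
rewrite (ls_charge_wenergy wn') ?rE ?sum_wenergy_foldr ?all_ord //.
(* Dominance of the weight only concerns nodes; for [j.+1 >= n] the letter [j.+1] does not occur at
   all. *)
rewrite -rE => j; have [jn|nj] := ltnP j.+1 n; last first.
  suff /count_memPn -> : j.+1 \notin reading (foldr (@weyl n _) (psi b) s) by [].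
  by apply/negP => /(allP wn'); rewrite ltnNge nj.
have jn' : (j < n.-1)%N by lia.
by have := dT' (Ordinal jn'); rewrite !mxE /= lez_nat.
Qed.
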